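(* Let $d\ge 2$ and let $P\subseteq M_{\mathbb R}$ be a $d$-dimensional reflexive simplex. Then $$(d+1)^{d+1}\le \mathrm{Vol}(P)\,\mathrm{Vol}(P^* )\le t_d^2,$$ with equality in the first bound if and only if the sum of the vertices of $P$ equals $0$, and equality in the second bound if and only if $P\cong S_{Q_d}$ (in this case $P\cong P^*$). Furthermore, suppose that the vertices of $P^*$ generate the lattice $N$. Then $$\mathrm{Vol}(P^* )\le t_d,$$ with equality if and only if $P^*\cong S_{Q_d}\cong P$.
   Context: Let $M,N$ be dual lattices of rank $d\ge 2$ with pairing $\langle\cdot,\cdot\rangle: M\times N\to\mathbb{Z}$, and $M_{\mathbb{R}}=M\otimes_{\mathbb Z}\mathbb{R}$, $N_{\mathbb{R}}=N\otimes_{\mathbb Z}\mathbb{R}$. A lattice polytope in $M_{\mathbb R}$ is a polytope whose vertices lie in $M$ (similarly for $N$). The (normalized) volume $\mathrm{Vol}(P)$ of a lattice polytope is $d!$ times its Euclidean volume with respect to a lattice basis. Two lattice polytopes are isomorphic, written $P_1\cong P_2$, if there is a lattice isomorphism (of the respective ambient lattices) inducing an affine bijection between their affine hulls that maps the faces of one onto the faces of the other. A reflexive polytope $P\subseteq M_{\mathbb R}$ is a $d$-dimensional lattice polytope containing the origin in its interior such that its dual polytope $P^*=\{x\in N_{\mathbb R}: \langle y,x\rangle\ge -1\ \forall y\in P\}$ is also a lattice polytope. A reflexive simplex is a reflexive polytope that is a simplex. Sylvester sequence: $y_0=2$, $y_n=1+y_0\cdots y_{n-1}$ for $n\ge1$;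 and $t_n=y_n-1$ for $n\ge 0$. The Sylvester weight system of length $d$ is the $(d+1)$-tuple $$Q_d=\left(\frac{t_d}{y_0},\ldots,\frac{t_d}{y_{d-1}},1\right).$$ For a $(d+1)$-tuple $Q=(q_0,\ldots,q_d)$ of positive integers with $q_d=1$, put $|Q|=q_0+\cdots+q_d$; if $k_i=|Q|/q_i$ is an integer for all $i=0,\ldots,d-1$, define $$S_Q=\mathrm{conv}(k_0e_0-u,\ldots,k_{d-1}e_{d-1}-u,-u),\qquad u=e_0+\cdots+e_{d-1},$$ where $e_0,\ldots,e_{d-1}$ is a $\mathbb{Z}$-basis of $M$. *)

(* Defs.v *)
From HB Require Import structures.
From mathcomp Require Import all_boot all_order all_algebra.
From mathcomp Require Import all_classical all_reals all_analysis.

Set Implicit Arguments.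
Unset Strict Implicit.
Unset Printing Implicit Defensive.

Import Order.TTheory GRing.Theory Num.Theory.
Import numFieldNormedType.Exports.

Local Open Scope classical_set_scope.
Local Open Scope ring_scope.

(** A pair of dual lattices of rank [d] is coordinatized by
    a lattice basis and its dual basis: both [M_R] and [N_R] are ['rV[R]_d],
    both [M] and [N] are the integral vectors, and the pairing is the standard
    scalar product. *)

Section Polytopes.
Variable R : realType.

Section Dim.
Variable d : nat.
Implicit Types (x y u v : 'rV[R]_d) (A F P : set 'rV[R]_d).

Definition lattice : set 'rV[R]_d := [set x | x \is a mxOver Num.int].

Definition pairing x y : R := \sum_(i < d) x 0 i * y 0 i.

Definition conv_hull A : set 'rV[R]_d := smallest (@convex_set R 'rV[R]_d) A.

Definition aff A : set 'rV[R]_d :=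
  [set x | exists n (w : 'I_n -> R) (p : 'I_n -> 'rV[R]_d),
     [/\ forall i, A (p i), \sum_i w i = 1 & x = \sum_i w i *: p i]].

Definition polytope P := exists s : seq 'rV[R]_d, P = conv_hull [set` s].

(** The empty set and [P] itself (case [u = 0]) count as faces of [P]. *)
Definition face P F := exists u (c : R),
  (forall x, P x -> c <= pairing x u) /\ F = [set x | P x /\ pairing x u = c].

Definition vertices P : set 'rV[R]_d := [set v | face P [set v]].

Definition lattice_polytope P := polytope P /\ vertices P `<=` lattice.

Definition full_dim P := aff P = setT.

Definition dual_polytope P : set 'rV[R]_d :=
  [set x | forall y, P y -> -1 <= pairing y x].

Definition reflexive_polytope P :=
  [/\ lattice_polytope P, full_dim P, interior P 0 & lattice_polytope (dual_polytope P)].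

Definition aff_indep n (v : 'I_n -> 'rV[R]_d) := forall w : 'I_n -> R,
  \sum_i w i = 0 -> \sum_i w i *: v i = 0 -> forall i, w i = 0.

Definition simplex P :=
  exists n (v : 'I_n.+1 -> 'rV[R]_d), aff_indep v /\ P = conv_hull (range v).

Definition lattice_span A : set 'rV[R]_d :=
  smallest [set G : set 'rV[R]_d | G 0 /\ forall x y, G x -> G y -> G (x - y)] A.

(** Lattice isomorphisms [Z^d -> Z^d] are given by [GL_d(Z)], acting on row
    vectors from the right. *)
Definition lattice_iso P1 P2 :=
  exists2 U : 'M[int]_d, U \in unitmx &
    let phi x := x *m map_mx intr U in
    [/\ set_bij (aff P1) (aff P2) phi,
        forall F, face P1 F -> face P2 (phi @` F) &
        forall F', face P2 F' -> exists2 F, face P1 F & F' = phi @` F].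

(** Meant for [Q ord_max = 1] and each [k i] an integer. *)
Definition S_ (Q : 'I_d.+1 -> nat) : set 'rV[R]_d :=
  let k (i : 'I_d) : R := (\sum_j Q j)%:R / (Q (widen_ord (leqnSn d) i))%:R in
  let e (i : 'I_d) : 'rV[R]_d := delta_mx 0 i in
  let u := \sum_i e i in
  conv_hull ([set k i *: e i - u | i in [set: 'I_d]] `|` [set - u]).

End Dim.

(** [d]-dimensional Lebesgue measure as the [d]-fold product of
    [lebesgue_measure] on [R]; one step integrates the measure of the sections,
    as in the product measure [m1 \x m2]. *)
Fixpoint volume (d : nat) : set 'rV[R]_d -> \bar R :=
  match d with
  | 0 => fun A => (\1_A 0)%:E
  | d'.+1 => fun A => (\int[lebesgue_measure]_(t in [set: R])
      volume [set y : 'rV[R]_d' | A (row_mx (t%:M : 'rV[R]_1) y)])%E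
  end.

Definition Vol (d : nat) (P : set 'rV[R]_d) : \bar R :=
  ((d`!)%:R%:E * volume P)%E.

End Polytopes.

Arguments S_ R {d} Q.
Arguments lattice R d : clear implicits.

(** [:: y_0; ...; y_(n-1)] *)
Fixpoint sylvester_prefix (n : nat) : seq nat :=
  if n is m.+1 then
    let s := sylvester_prefix m in rcons s (1 + \prod_(y <- s) y)%N
  else [::].

Definition sylvester (n : nat) : nat :=
  (1 + \prod_(y <- sylvester_prefix n) y)%N.

Definition sylvester_t (n : nat) : nat := (sylvester n - 1)%N.

Lemma sylvester0 : sylvester 0 = 2.
Proof. by rewrite /sylvester big_nil. Qed.

Lemma sylvesterE n : sylvester n = (1 + \prod_(i < n) sylvester i)%N.
Proof.
congr (1 + _)%N; elim: n => [|n IHn]; first by rewrite big_nil big_ord0.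
by rewrite big_ord_recr -IHn /= -cats1 big_cat big_seq1.
Qed.

Definition sylvester_weights (d : nat) (i : 'I_d.+1) : nat :=
  if (i < d)%N then (sylvester_t d %/ sylvester i)%N else 1.

Lemma sylvester_dvd_t d i : (i < d)%N -> (sylvester i %| sylvester_t d)%N.
Proof.
by move=> id; rewrite /sylvester_t (sylvesterE d) addKn (bigD1 (Ordinal id))// dvdn_mulr.
Qed.

(* Main.v *)
(** Let [v_i] be the vertices of [P], [b_i] the barycentric coordinates of [0] and
    [w_j] the vertices of the dual, indexed by opposite facets. Then
    [<v_i, w_j> = k_i delta_ij - 1] with [k_i = 1 / b_i], so the [k_i] are integers with
    [sum_i 1 / k_i = 1] and, writing [Vol] as the determinant of the homogenized vertex
    matrix, [Vol P * Vol P^* = prod_i k_i]. The lower bound is AM-GM. The upper bound is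
    the extremality of the Sylvester sequence among unit fraction partitions of [1],
    obtained by comparing the products of initial segments through log-majorization.
    Each [k_i] divides both volumes (cofactor expansion), so in the equality case both
    are equal to [t_d], whence the vertices other than the one of weight [k_d = t_d]
    form a lattice basis and [P] is determined up to isomorphism. If the [w_j] generate
    the lattice, then [Vol P^*] divides [Vol P], which gives the last part. *)
Require Import Defs.
From HB Require Import structures.
From mathcomp Require Import all_boot all_order all_algebra fingroup perm.
From mathcomp Require Import all_classical all_reals all_analysis.
From mathcomp Require Import measurable_realfun zify ring lra.
Import Order.TTheory GRing.Theory Num.Theory.
Import numFieldNormedType.Exports.
Local Open Scope classical_set_scope.
Local Open Scope ring_scope.

Set Implicit Arguments.
Unset Strict Implicit.
Unset Printing Implicit Defensive.

(** * Volume of polyhedra and simplices *)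

Section Volume.
Variable R : realType.
Local Notation mu := (@lebesgue_measure R).

(** [volume] is an iterated integral in a fixed order of coordinates, so its behaviour under linear
    maps is not built in. Polyhedra [x *m A <= b] make it provable: a section at a fixed first
    coordinate is again one, with a right-hand side affine in that coordinate, so inductions on the
    dimension never leave the class. A full-dimensional simplex is then an affine image of the
    standard one.

    The geometry is carried by the single identity [homog V *m (homog W)^T = diag_mx k]. Prefixing
    the vertices with 1 makes affine relations linear, and the identity is symmetric in [V] and [W],
    so each fact about a simplex also holds for its dual.

    The upper bound and its equality case come from one statement: a unit fraction partition with
    product at least [t_d^2] is, up to order, the Sylvester one. The Sylvester numbers enter because
    they turn the integrality estimate [1 - sum 1/k_i >= prod 1/k_i] into an equality on every
    initial segment. *)

Lemma measurable_affine (a c : R) :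
  measurable_fun [set: R] (fun t : R => a * t + c).
Proof. by apply: measurable_funD => //; apply: measurable_funM. Qed.

Lemma lebesgue_measure_preimage_affine (a c x y : R) : a != 0 ->
  mu ((fun t : R => a * t + c) @^-1` `]x, y]) = (`|a|^-1%:E * mu `]x, y])%E.
Proof.
move=> a0.
have [a_gt0|] := ltP 0 a.
  rewrite (_ : _ @^-1` _ = `](x - c) / a, (y - c) / a]%classic); last first.
    apply/seteqP; split=> t /=; rewrite !in_itv/= ltr_pdivrMr// ler_pdivlMr//.
      by rewrite ltrBlDr lerBrDr [a * t]mulrC.
    by rewrite ltrBlDr lerBrDr [a * t]mulrC.
  rewrite !lebesgue_measure_itv/= !lte_fin ltr_pM2r ?invr_gt0// ltrD2r.
  case: ifP => _; rewrite ?mule0// -!EFinB -EFinM gtr0_norm//; congr _%:E.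
  by field; rewrite a0.
rewrite le_eqVlt (negbTE a0)/= => a_lt0.
rewrite (_ : _ @^-1` _ = `[(y - c) / a, (x - c) / a[%classic); last first.
  apply/seteqP; split=> t /=; rewrite !in_itv/= ltr_ndivlMr// ler_ndivrMr//.
    by rewrite ltrBlDr lerBrDr [a * t]mulrC andbC.
  by rewrite ltrBlDr lerBrDr [a * t]mulrC andbC.
rewrite !lebesgue_measure_itv/= !lte_fin ltr_nM2r ?invr_lt0// ltrD2r.
case: ifP => _; rewrite ?mule0// -!EFinB -EFinM ltr0_norm//; congr _%:E.
by field; rewrite a0.
Qed.

(** Lebesgue measure is determined by its values on half-open intervals, so it equals [|a|] times
    its own pushforward along [t -> a * t + c]. *)
Lemma integral_affine (a c : R) (f : R -> \bar R) : a != 0 ->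
  measurable_fun [set: R] f -> (forall t, 0 <= f t)%E ->
  (\int[mu]_(t in [set: R]) f (a * t + c)%R =
   `|a|^-1%:E * \int[mu]_(t in [set: R]) f t)%E.
Proof.
move=> a0 mf f0.
pose phi : measurableTypeR R -> measurableTypeR R := fun t => a * t + c.
have mphi : measurable_fun [set: measurableTypeR R] phi by exact: measurable_affine.
have a_ge0 : 0 <= `|a| by [].
pose nu := mscale (NngNum a_ge0) (pushforward mu phi) :
  {measure set (measurableTypeR R) -> \bar R}.
have eq_nu (A : set R) : measurable A -> mu A = nu mphi A.
  apply: lebesgue_measure_unique => _ [[x y] _ <-] /=.
  rewrite /nu /mscale /= /pushforward lebesgue_measure_preimage_affine// muleA -EFinM.
  by rewrite divff ?normr_eq0// mul1e.
rewrite [in RHS](@eq_measure_integral _ _ _ _ (nu mphi)); last first.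
  by move=> A mA _; exact: (eq_nu A mA).
rewrite ge0_integral_mscale// (ge0_integral_pushforward mphi)//.
by rewrite muleA -EFinM mulVf ?normr_eq0// mul1e preimage_setT.
Qed.

(** Points are row vectors, so each column of [A] is one inequality. Unbounded and empty polyhedra
    are allowed, which keeps the class closed under sections. *)
Definition polyhedron n m (A : 'M[R]_(n, m)) (b : 'rV[R]_m) : set 'rV[R]_n :=
  [set x | forall j, (x *m A) 0 j <= b 0 j].

Lemma volume_polyhedronS n m (A : 'M[R]_(1 + n, m)) (b : 'rV[R]_m) :
  volume (polyhedron A b) = (\int[mu]_(t in [set: R])
    volume (polyhedron (dsubmx A) (b - t *: usubmx A)))%E.
Proof.
apply: eq_integral => t _; congr volume; apply/funext => y; apply/propext.
rewrite /polyhedron /= -{1}(vsubmxK A) mul_row_col mul_scalar_mx.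
by split=> H j; have := H j; rewrite !mxE lerBrDl.
Qed.

Lemma volume_ge0 n (A : set 'rV[R]_n) : (0 <= volume A)%E.
Proof.
elim: n A => [|n IHn] A /=; first by rewrite lee_fin indicE ler0n.
by apply: integral_ge0 => t _; exact: IHn.
Qed.

(** The parameter space [T] is arbitrary because the induction enlarges it: the section coordinate
    joins the parameter in [T * R], and Tonelli makes the inner integral measurable in [T]. *)
Lemma measurable_volume_polyhedron d (T : measurableType d) n m (A : 'M[R]_(n, m))
    (b : T -> 'rV[R]_m) :
  (forall j, measurable_fun [set: T] (fun s => b s 0 j)) ->
  measurable_fun [set: T] (fun s => volume (polyhedron A (b s))).
Proof.
elim: n => [|n IHn] in d T A b * => mb.
  rewrite (_ : (fun s => _) =
    EFin \o (\1_(\bigcap_(j in [set: 'I_m]) [set s | 0 <= b s 0 j]) : T -> R)).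
    apply/measurable_EFinP/measurable_indic.
    apply: fin_bigcap_measurable => // j _.
    rewrite -[X in measurable X]setTI.
    rewrite (_ : [set s | _] = (fun s => b s 0 j) @^-1` `[0, +oo[); last first.
      by apply/seteqP; split=> s /=; rewrite in_itv/= andbT.
    exact: mb.
  apply/funext => s /=; rewrite !indicE; congr (_%:R%:E); congr nat_of_bool.
  apply/idP/idP; rewrite !inE => H j; first by move=> _; have := H j; rewrite mul0mx mxE.
  by rewrite mul0mx mxE; exact: H.
under eq_fun do rewrite (@volume_polyhedronS n m A).
pose f (z : T * measurableTypeR R) := volume (polyhedron (dsubmx (A : 'M[R]_(1 + n, m)))
  (b z.1 - z.2 *: usubmx (A : 'M[R]_(1 + n, m)))).
apply: (@measurable_fun_fubini_tonelli_F _ _ _ _ _ mu f).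
  apply: IHn => j.
  rewrite (_ : (fun _ => _) = (fun z : T * measurableTypeR R =>
    b z.1 0 j - z.2 * usubmx (A : 'M[R]_(1 + n, m)) 0 j)).
    apply: measurable_funB; first exact: (measurableT_comp (mb j) measurable_fst).
    by apply: measurable_funM => //; exact: measurable_snd.
  by apply/funext => z; rewrite !mxE.
by move=> z; exact: volume_ge0.
Qed.

End Volume.

(** * Linear change of variables *)

Section VolumeLinear.
Variable R : realType.
Local Notation mu := (@lebesgue_measure R).

Lemma measurable_volume_section n m (A : 'M[R]_(n, m)) (b a0 : 'rV[R]_m) :
  measurable_fun [set: R] (fun t : R => volume (polyhedron A (b - t *: a0))).
Proof.
apply: measurable_volume_polyhedron => j.
rewrite (_ : (fun _ => _) = (fun t : R => b 0 j - t * a0 0 j)).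
  by apply: measurable_funB => //; apply: measurable_funM.
by apply/funext => z; rewrite !mxE.
Qed.

Lemma volume_polyhedron_translate n m (A : 'M[R]_(n, m)) b c :
  volume (polyhedron A (b + c *m A)) = volume (polyhedron A b).
Proof.
elim: n => [|n IHn] in A b c *; first by rewrite (thinmx0 c) mul0mx addr0.
rewrite 2!(@volume_polyhedronS _ n m A).
set A0 := usubmx _; set A' := dsubmx _.
pose c0 := lsubmx (c : 'M[R]_(1, 1 + n)) 0 0; pose c' := rsubmx (c : 'M[R]_(1, 1 + n)).
have -> : c *m A = c0 *: A0 + c' *m A'.
  rewrite -mul_scalar_mx -mul_row_col -mx11_scalar; congr (_ *m _).
    by rewrite hsubmxK.
  by rewrite vsubmxK.
under eq_integral => t _.
  have -> : b + (c0 *: A0 + c' *m A') - t *: A0 =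
      (b - (1 * t - c0) *: A0) + c' *m A'.
    by rewrite mul1r scalerBl opprB -!addrA [c' *m _ - _]addrC.
  rewrite IHn.
  over.
rewrite (integral_affine (- c0) (oner_neq0 _)
  (measurable_volume_section A' b A0)) ?normr1 ?invr1 ?mul1e// => t.
exact: volume_ge0.
Qed.

(** [polyhedron (M *m A) b] is the preimage of [polyhedron A b] under [x -> x *m M], hence the
    inverse determinant. *)
Definition volume_scaling n (M : 'M[R]_n) := forall m (A : 'M[R]_(n, m)) b,
  volume (polyhedron (M *m A) b) = (`|\det M|^-1%:E * volume (polyhedron A b))%E.

Lemma volume_scaling_cancel n (X M : 'M[R]_n) : X \in unitmx ->
  volume_scaling X -> volume_scaling (X *m M) -> volume_scaling M.
Proof.
rewrite unitmxE unitfE -normr_eq0 => X0 sX sXM m A b.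
have := sXM m A b; rewrite -mulmxA sX det_mulmx normrM invfM EFinM -muleA.
move/(congr1 (fun z => `|\det X|%:E * z)%E).
by rewrite !muleA -!EFinM divff// !mul1r mul1e.
Qed.

(** The section at [t] is a translate of a section at [a * t], pulled back by [N]; the off-diagonal
    row [r] contributes only that translation. *)
Lemma volume_scaling_ublock n (a : R) (r : 'rV[R]_n) (N : 'M[R]_n) : a != 0 ->
  volume_scaling N -> volume_scaling (block_mx a%:M r 0 N : 'M[R]_(1 + n)).
Proof.
move=> a0 sN m A b.
rewrite det_ublock det_scalar1 2!volume_polyhedronS.
set A0 := usubmx A; set A' := dsubmx A.
have -> : block_mx a%:M r 0 N *m A = col_mx (a *: A0 + r *m A') (N *m A').
  by rewrite -{1}(vsubmxK A) mul_block_col mul0mx add0r mul_scalar_mx.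
rewrite col_mxKu col_mxKd.
under eq_integral => t _.
  have -> : b - t *: (a *: A0 + r *m A') = b - (a * t + 0) *: A0 + (- t *: r) *m A'.
    by rewrite addr0 -scalemxAl scalerDr scalerA scaleNr opprD addrA [a * t]mulrC.
  rewrite sN volume_polyhedron_translate.
  over.
have mf : measurable_fun [set: measurableTypeR R]
    (fun t : R => volume (polyhedron A' (b - (a * t + 0) *: A0))).
  exact: (measurableT_comp (measurable_volume_section A' b A0) (measurable_affine a 0)).
rewrite (ge0_integralZl mu _ mf) => [||t _|].
- rewrite (integral_affine 0 a0 (measurable_volume_section A' b A0)).
    by rewrite muleA -EFinM normrM invfM mulrC.
  by move=> t; exact: volume_ge0.
- exact: measurableT.
- exact: volume_ge0.
- by rewrite lee_fin invr_ge0.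
Qed.

Lemma volume_polyhedron_swap n m (a0 a1 : 'rV[R]_m) (A : 'M[R]_(n, m)) b :
  volume (polyhedron (col_mx a0 (col_mx a1 A)) b) =
  volume (polyhedron (col_mx a1 (col_mx a0 A)) b).
Proof.
have iter (c0 c1 : 'rV[R]_m) :
    volume (polyhedron (col_mx c0 (col_mx c1 A)) b) =
    (\int[mu]_s \int[mu]_t volume (polyhedron A (b - s *: c0 - t *: c1)))%E.
  rewrite volume_polyhedronS; apply: eq_integral => s _.
  rewrite col_mxKu col_mxKd volume_polyhedronS; apply: eq_integral => t _.
  by rewrite col_mxKu col_mxKd.
rewrite !iter.
pose f (z : measurableTypeR R * measurableTypeR R) :=
  volume (polyhedron A (b - z.1 *: a0 - z.2 *: a1)).
rewrite (fubini_tonelli f); last 2 first.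
- apply: measurable_volume_polyhedron => j.
  rewrite (_ : (fun _ => _) = (fun z => b 0 j - z.1 * a0 0 j - z.2 * a1 0 j)).
    apply: measurable_funB; last first.
      by apply: measurable_funM => //; exact: measurable_snd.
    apply: measurable_funB => //.
    by apply: measurable_funM => //; exact: measurable_fst.
  by apply/funext => z; rewrite !mxE.
- by move=> z; exact: volume_ge0.
by apply: eq_integral => t _; apply: eq_integral => s _; rewrite /f /= addrAC.
Qed.

Lemma col_to_delta n (c : 'cV[R]_(1 + n)) : c != 0 ->
  exists2 Q : 'M[R]_(1 + n), Q \in unitmx & Q *m c = col_mx 1%:M 0.
Proof.
move=> c0; have rc : \rank c = 1%N.
  by apply/eqP; rewrite eqn_leq rank_leq_col lt0n mxrank_eq0.
have := mulmx_ebase c; rewrite rc.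
set L := col_ebase c; set u := row_ebase c.
have Lu : L \in unitmx by exact: col_ebase_unit.
have uu : u \in unitmx by exact: row_ebase_unit.
have u0 : u 0 0 != 0 by move: uu; rewrite unitmxE unitfE (mx11_scalar u) det_scalar1 mxE.
move=> <-; exists ((u 0 0)^-1 *: invmx L).
  by rewrite unitmxZ ?unitmx_inv// unitfE invr_eq0.
rewrite -scalemxAl !mulmxA mulVmx// mul1mx {2}(mx11_scalar u) mul_mx_scalar.
rewrite scalerA mulVf// scale1r.
apply/matrixP => i j; rewrite !ord1 !mxE.
by case: splitP => k ki; rewrite !mxE ?ord1 -?val_eqE /= ki ?ord1.
Qed.

Definition swap01 n : 'M[R]_(1 + (1 + n)) :=
  col_mx (row_mx 0 (row_mx 1%:M 0))
    (col_mx (row_mx 1%:M (row_mx 0 0)) (row_mx 0 (row_mx 0 1%:M))).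

Lemma mul_swap01 n m (a0 a1 : 'rV[R]_m) (A : 'M[R]_(n, m)) :
  swap01 n *m col_mx a0 (col_mx a1 A) = col_mx a1 (col_mx a0 A).
Proof.
by rewrite /swap01 !mul_col_mx !mul_row_col !mul0mx !mul1mx !addr0 !add0r.
Qed.

Lemma swap01_sqr n : swap01 n *m swap01 n = 1%:M.
Proof.
rewrite {2}/swap01 mul_swap01 row_mx0 -(block_mxEv 0 (row_mx 1%:M 0)) block_mxEh.
by rewrite col_mx0 -block_mxEv -scalar_mx_block -block_mxEv -scalar_mx_block.
Qed.

Lemma volume_scaling_swap01 n : volume_scaling (swap01 n).
Proof.
move=> m A b; have -> : `|\det (swap01 n)| = 1.
  have := congr1 determinant (swap01_sqr n); rewrite det_mulmx det1.
  move=> /(congr1 Num.norm); rewrite normrM normr1 -expr2 => /eqP.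
  by rewrite sqrp_eq1// => /eqP.
rewrite invr1 mul1e -(vsubmxK A) -(vsubmxK (dsubmx A)) mul_swap01.
exact: volume_polyhedron_swap.
Qed.

(** Row operations among the lower rows and one swap make [M] block triangular;
    block triangular matrices are handled by recursion on the dimension, so that
    Fubini is needed for the swap only. *)
Lemma volume_scaling_unitmx n (M : 'M[R]_n) : M \in unitmx -> volume_scaling M.
Proof.
elim: n => [|n IHn] in M *.
  by move=> _ m A b; rewrite det_mx00 normr1 invr1 mul1e (flatmx0 A) mulmx0.
have triangular (M' : 'M[R]_(1 + n)) : M' \in unitmx -> dlsubmx M' = 0 -> volume_scaling M'.
  move=> uM c0; move: uM; rewrite -(submxK M') c0 (mx11_scalar (ulsubmx M')).
  rewrite unitmxE det_ublock unitrM unitfE det_scalar1 => /andP[a0 uN].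
  by apply: volume_scaling_ublock => //; apply: IHn; rewrite unitmxE.
move=> uM; have [/(triangular _ uM)//|c0] := eqVneq (dlsubmx (M : 'M[R]_(1 + n))) 0.
case: n => [|n] in IHn M triangular uM c0 *; first by rewrite flatmx0 eqxx in c0.
have [Q uQ Qc] := col_to_delta c0.
move: (ulsubmx (M : 'M[R]_(1 + (1 + n)))) (ursubmx (M : 'M[R]_(1 + (1 + n))))
  (dlsubmx (M : 'M[R]_(1 + (1 + n)))) (drsubmx (M : 'M[R]_(1 + (1 + n))))
  (submxK (M : 'M[R]_(1 + (1 + n)))) c0 Qc => p q c N defM c0 Qc.
(* [B1] brings the first column to [(p, 1, 0, ..., 0)], [B2] clears [p] with the second row, and the
   swap moves the 1 to the top. *)
pose B1 : 'M[R]_(1 + (1 + n)) := block_mx 1%:M 0 0 Q.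
pose B2 : 'M[R]_(1 + (1 + n)) := block_mx 1%:M (row_mx (- p) 0) 0 1%:M.
have uB1 : B1 \in unitmx by rewrite unitmxE det_ublock det1 mul1r -unitmxE.
have uB2 : B2 \in unitmx by rewrite unitmxE det_ublock !det1 mulr1 unitr1.
have uS : swap01 n \in unitmx by case/mulmx1_unit: (swap01_sqr n).
apply: (volume_scaling_cancel uB1).
  by apply: volume_scaling_ublock; [exact: oner_neq0 | exact: IHn].
apply: (volume_scaling_cancel uB2).
  by apply: volume_scaling_ublock; [exact: oner_neq0 | apply: IHn; exact: unitmx1].
apply: (volume_scaling_cancel uS); first exact: volume_scaling_swap01.
apply: triangular; first by rewrite !unitmx_mul uS uB1 uB2.
rewrite -defM /B1 /B2 !mulmx_block !mul1mx !mul0mx !addr0 !add0r Qc.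
rewrite mul_row_col mulmx1 mul0mx addr0 subrr.
rewrite -(vsubmxK (Q *m N)) block_mxEv -block_mxEh block_mxEv mul_swap01.
by rewrite /dlsubmx col_mxKd -block_mxEv block_mxEh row_mxKl col_mx0.
Qed.

End VolumeLinear.

(** * Volume of the standard simplex and of its affine images *)

Section SimplexVolume.
Variable R : realType.
Local Notation mu := (@lebesgue_measure R).

Lemma integral_simplex_section n (s : R) : 0 <= s ->
  (\int[mu]_(t in `[0%R, s]) ((s - t) ^+ n / n`!%:R)%R%:E =
   (s ^+ n.+1 / n.+1`!%:R)%R%:E)%E.
Proof.
rewrite le_eqVlt => /predU1P[<-|s0].
  by rewrite set_itv1 integral_set1 expr0n mul0r.
pose q : {poly R} := n`!%:R^-1 *: (s%:P - 'X) ^+ n.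
pose p : {poly R} := - (n.+1`!%:R^-1 *: (s%:P - 'X) ^+ n.+1).
have dp : p^`()%R = q.
  rewrite /p derivN derivZ deriv_exp derivB derivC derivX sub0r mulN1r mulNrn.
  rewrite scalerN opprK /= -[X in _ *: X]scaler_nat scalerA; congr (_ *: _).
  rewrite factS natrM invfM mulrC mulrA divff ?mul1r// pnatr_eq0//.
have -> : (fun t : R => ((s - t) ^+ n / n`!%:R)%:E) = (fun t => (q.[t])%:E).
  by apply/funext => t; rewrite /q !hornerE mulrC.
rewrite (@continuous_FTC2 _ (horner q) (horner p))//.
- by rewrite -EFinB /p !hornerE subrr expr0n /= mulr0 oppr0 addr0 sub0r opprK mulrC.
- by apply: continuous_subspaceT; exact: continuous_horner.
- split => [x _||]; first exact: derivable_horner.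
  + by apply: cvg_at_right_filter; exact: continuous_horner.
  + by apply: cvg_at_left_filter; exact: continuous_horner.
- by move=> x _; rewrite -derivE dp.
Qed.

Lemma volume_set0 n : volume (set0 : set 'rV[R]_n) = 0%E.
Proof.
elim: n => [|n IHn] /=; first by rewrite indicE in_set0.
by apply: integral0_eq => t _; exact: IHn.
Qed.

Definition std_simplex n (s : R) : set 'rV[R]_n :=
  [set x | (forall i, 0 <= x 0 i) /\ \sum_i x 0 i <= s].

Arguments std_simplex : clear implicits.

(** The size [s] varies because the slice at [t] is the simplex of size [s - t]. For negative [s]
    the set is empty while the formula need not vanish, hence the case distinction. *)
Lemma volume_std_simplex n (s : R) :
  volume (std_simplex n s) = if 0 <= s then (s ^+ n / n`!%:R)%:E else 0%E.
Proof.
elim: n s => [|n IHn] s.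
  rewrite /= indicE fact0 expr0 divr1.
  case: ifPn => s0; [rewrite mem_set|rewrite memNset]=> //=; rewrite /std_simplex/= big_ord0.
    by split=> // -[].
  by move=> [_]; apply/negP.
have section (t : R) :
    volume [set y : 'rV[R]_n | std_simplex n.+1 s (row_mx (t%:M : 'rV_1) y)] =
    if 0 <= t <= s then ((s - t) ^+ n / n`!%:R)%:E else 0%E.
  have row0 (y : 'rV[R]_n) : (row_mx (t%:M : 'rV_1) y) 0 0 = t.
    by rewrite mxE; case: splitP => [j _|j]//; rewrite mxE !ord1.
  have rowS (y : 'rV[R]_n) i : (row_mx (t%:M : 'rV_1) y) 0 (lift 0 i) = y 0 i.
    rewrite mxE; case: splitP => [[[]]//|j]; rewrite lift0 add1n => -[] ij.
    by congr (y _ _); apply/val_inj.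
  have [t0|t0] := leP 0 t; last first.
    rewrite (_ : [set y | _] = set0) ?volume_set0//; apply/seteqP; split=> y //= -[/(_ 0)].
    by rewrite row0 leNgt t0.
  rewrite (_ : [set y | _] = std_simplex n (s - t)) ?IHn ?subr_ge0//.
  apply/seteqP; split=> y /= [H1 H2].
    split=> [i|]; first by rewrite -rowS.
    by rewrite lerBrDl; move: H2; rewrite big_ord_recl row0; under eq_bigr do rewrite rowS.
  split=> [i|].
    by case: (unliftP 0 i) => [j|] ->; rewrite ?rowS ?row0.
  by rewrite big_ord_recl row0; under eq_bigr do rewrite rowS; rewrite -lerBrDl.
transitivity (\int[mu]_t
    ((fun t : R => ((s - t) ^+ n / n`!%:R)%:E) \_ `[0%R, s]) t)%E.
  apply: eq_integral => t _; rewrite [LHS]section patchE; case: ifPn => H.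
    by rewrite mem_set//= in_itv.
  by rewrite memNset//= in_itv/=; apply/negP.
rewrite -integral_mkcond; case: ifPn => s0; first exact: integral_simplex_section.
by rewrite set_itv_ge ?integral_set0// bnd_simp.
Qed.

End SimplexVolume.
Arguments std_simplex {R} n s.

Section HullVolume.
Variable R : realType.

Definition hull n d (V : 'M[R]_(n, d)) : set 'rV[R]_d :=
  [set x | exists l : 'rV[R]_n,
    [/\ forall i, 0 <= l 0 i, \sum_i l 0 i = 1 & x = l *m V]].

(** The matrix of homogeneous coordinates [(1, v_i)]: affine combinations of the rows of [V] become
    linear ones. *)
Definition homog n d (V : 'M[R]_(n, d)) : 'M[R]_(n, 1 + d) := row_mx (const_mx 1) V.

Lemma mul_const1 n m (l : 'rV[R]_n) (v : 'rV[R]_m) :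
  l *m (const_mx 1 *m v) = (\sum_i l 0 i) *: v.
Proof.
rewrite mulmxA (_ : l *m const_mx 1 = (\sum_i l 0 i)%:M) ?mul_scalar_mx//.
by apply/matrixP => i j; rewrite !ord1 !mxE mulr1n; apply: eq_bigr => k _; rewrite mxE mulr1.
Qed.

(** With [v0] the first vertex and [M] the matrix of edges at [v0], the hull is the preimage of the
    standard simplex under [x -> (x - v0) *m invmx M]. Subtracting the first row from the others
    gives [\det (homog V) = \det M]. *)
Lemma volume_hull d (V : 'M[R]_(1 + d, d)) : homog V \in unitmx ->
  volume (hull V) = (`|\det (homog V)| / d`!%:R)%:E.
Proof.
pose v0 := usubmx V; pose M := dsubmx V - const_mx 1 *m v0.
have detM : \det (homog V) = \det M.
  pose L : 'M[R]_(1 + d) := block_mx 1%:M 0 (- const_mx 1) 1%:M.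
  have -> : \det (homog V) = \det (L *m homog V).
    by rewrite det_mulmx det_lblock !det1 !mul1r.
  have -> : homog V = block_mx 1%:M v0 (const_mx 1) (dsubmx V).
    rewrite /homog -[in LHS](vsubmxK V) block_mxEh; congr (row_mx _ _).
    apply/matrixP => i j; rewrite !mxE; case: splitP => k _; rewrite !mxE//.
    by rewrite !ord1 eqxx.
  rewrite /L mulmx_block !mul1mx !mul0mx !addr0 mulmx1 addNr det_ublock det1 mul1r.
  by rewrite addrC mulNmx.
rewrite unitmxE detM -unitmxE => uM.
pose A0 : 'M[R]_(d, d + 1) := row_mx (- 1%:M) (const_mx 1).
pose b0 : 'rV[R]_(d + 1) := row_mx 0 1%:M.
have stdE : polyhedron A0 b0 = std_simplex d (1 : R).
  apply/seteqP; split => x.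
    move=> H; split=> [i|].
      have := H (lshift 1 i); rewrite /A0 mul_mx_row mulmxN mulmx1.
      by rewrite !row_mxEl !mxE oppr_le0.
    have := H (rshift d 0); rewrite /A0 mul_mx_row !row_mxEr !mxE mulr1n.
    by under eq_bigr do rewrite mxE mulr1.
  case=> H1 H2 j; rewrite /A0 mul_mx_row mulmxN mulmx1.
  case: (split_ordP j) => k ->; first by rewrite !row_mxEl !mxE oppr_le0.
  rewrite !row_mxEr !mxE ord1 mulr1n.
  by under eq_bigr do rewrite mxE mulr1.
have hullE : hull V = polyhedron (invmx M *m A0) (b0 + v0 *m (invmx M *m A0)).
  have -> : polyhedron (invmx M *m A0) (b0 + v0 *m (invmx M *m A0)) =
      [set x | std_simplex d (1 : R) ((x - v0) *m invmx M)].
    rewrite -stdE; apply/seteqP.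
    by split=> x H j; have := H j; rewrite -mulmxA mulmxBl !mxE lerBlDr.
  apply/seteqP; split=> x.
    case=> l [l0 l1 ->] /=; rewrite -{1}(hsubmxK l) -{1}(vsubmxK V) mul_row_col.
    have sumr : \sum_i rsubmx (l : 'M[R]_(1, 1 + d)) 0 i = \sum_i l 0 (rshift 1 i).
      by apply: eq_bigr => i _; rewrite mxE.
    have e : lsubmx (l : 'M[R]_(1, 1 + d)) = (1 - \sum_i rsubmx (l : 'M[R]_(1, 1 + d)) 0 i)%:M.
      rewrite -l1 (@big_split_ord _ _ _ 1 d) /= big_ord1 [LHS]mx11_scalar mxE.
      by rewrite sumr addrK.
    have -> : lsubmx (l : 'M[R]_(1, 1 + d)) *m v0 +
        rsubmx (l : 'M[R]_(1, 1 + d)) *m dsubmx V - v0 =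
        rsubmx (l : 'M[R]_(1, 1 + d)) *m M.
      rewrite /M mulmxBr mul_const1 e mul_scalar_mx scalerBl scale1r.
      by rewrite addrAC [_ - _ - v0]addrAC subrr sub0r addrC.
    rewrite -mulmxA mulmxV// mulmx1; split=> [i|]; first by rewrite mxE.
    rewrite -l1 [leRHS](@big_split_ord _ _ _ 1 d) /= big_ord1.
    by rewrite sumr ler_wpDl.
  case=> H1 H2; pose l' := (x - v0) *m invmx M.
  exists (row_mx (1 - \sum_i l' 0 i)%:M l' : 'M[R]_(1, 1 + d)); split.
  - move=> i; case: (split_ordP (i : 'I_(1 + d))) => j ->.
      by rewrite row_mxEl ord1 mxE mulr1n subr_ge0.
    by rewrite row_mxEr.
  - rewrite (@big_split_ord _ _ _ 1 d) /= big_ord1 row_mxEl mxE mulr1n.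
    by under [X in _ + X]eq_bigr do rewrite row_mxEr; rewrite subrK.
  - rewrite -{1}(vsubmxK V) mul_row_col mul_scalar_mx scalerBl scale1r -mul_const1.
    rewrite -addrA [- _ + _]addrC -mulmxBr -/M -mulmxA mulVmx// mulmx1.
    by rewrite addrC subrK.
rewrite hullE volume_polyhedron_translate (volume_scaling_unitmx _); last by rewrite unitmx_inv.
rewrite stdE volume_std_simplex ler01 det_inv normrV ?invrK -?unitmxE//.
by rewrite expr1n -EFinM mul1r.
Qed.

End HullVolume.

(** * Unit fractions *)

Section UnitFractions.
Variable R : realType.
Implicit Types (x a : nat -> R) (k : nat -> nat).

Lemma mul_ln_div_le (u v : R) : 0 < u -> 0 < v -> u * ln (v / u) <= v - u.
Proof.
move=> u0 v0; have vu0 : 0 < v / u by rewrite divr_gt0.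
have := expR_ge1Dx (ln (v / u)); rewrite lnK ?posrE// -(ler_pM2l u0).
by rewrite mulrDr mulr1 mulrCA divff ?gt_eqF// mulr1 lerBrDl.
Qed.

Lemma mul_ln_div_lt (u v : R) : 0 < u -> 0 < v -> u != v -> u * ln (v / u) < v - u.
Proof.
move=> u0 v0 uv; have vu0 : 0 < v / u by rewrite divr_gt0.
have l0 : ln (v / u) != 0.
  apply: contra uv => /eqP l0; have : expR (ln (v / u)) = v / u by rewrite lnK.
  move: l0 => ->; rewrite expR0 => /(congr1 ( *%R^~ u)).
  rewrite mul1r divfK; last by rewrite gt_eqF.
  by move=> ->.
have := expR_gt1Dx l0; rewrite lnK ?posrE// -(ltr_pM2l u0).
by rewrite mulrDr mulr1 mulrCA divff ?gt_eqF// mulr1 ltrBrDl.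
Qed.

(** By Abel summation, [sum_(i < m) (a_i - x_i)] is at least
    [x_(m-1) * ln (prod a_i / prod x_i)]. *)
Lemma log_majorization x a m :
  (forall i, (i < m)%N -> 0 < x i) -> (forall i, (i < m)%N -> 0 < a i) ->
  (forall i, (i.+1 < m)%N -> x i.+1 <= x i) ->
  (forall j, (j <= m)%N -> \prod_(i < j) x i <= \prod_(i < j) a i) ->
  \sum_(i < m) x i <= \sum_(i < m) a i /\
  (\sum_(i < m) x i = \sum_(i < m) a i -> forall i, (i < m)%N -> x i = a i).
Proof.
move=> x0 a0 xD xa.
have P_gt0 (f : nat -> R) j : (forall i, (i < m)%N -> 0 < f i) -> (j <= m)%N ->
    0 < \prod_(i < j) f i.
  by move=> f0 jm; apply: prodr_gt0 => i _; rewrite f0// (leq_trans (ltn_ord i)).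
pose L j := ln (\prod_(i < j) a i / \prod_(i < j) x i).
have L_ge0 j : (j <= m)%N -> 0 <= L j.
  by move=> jm; rewrite ln_ge0// ler_pdivlMr ?P_gt0// mul1r xa.
have LS j : (j < m)%N -> L j.+1 = L j + ln (a j / x j).
  move=> jm; have jm' := ltnW jm.
  rewrite /L !big_ord_recr/= -lnM ?posrE ?divr_gt0 ?P_gt0 ?x0 ?a0//.
  by congr ln; rewrite mulf_div.
(* In the induction the weight [x j] may be lowered to [x j.+1] because [L] is nonnegative, and the
   new term is covered by [mul_ln_div_le]. If the sum vanishes, the strict form forces
   [x j.+1 = a j.+1], which leaves the sum for [j]. *)
suff key j : (j < m)%N ->
    x j * L j.+1 <= \sum_(i < j.+1) (a i - x i) /\
    (\sum_(i < j.+1) (a i - x i) = 0 -> forall i, (i < j.+1)%N -> x i = a i).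
  case: m => [|m] in x0 a0 xD xa P_gt0 L_ge0 LS key *; first by rewrite !big_ord0.
  have [h1 h2] := key m (ltnSn m).
  rewrite -subr_ge0 -sumrB; split.
    by rewrite (le_trans _ h1)// mulr_ge0 ?L_ge0// ltW ?x0.
  by move=> e i im; apply: h2 => //; rewrite sumrB e subrr.
elim: j => [|j IHj] jm.
  rewrite LS// !big_ord1 /L !big_ord0 divr1 ln1 add0r.
  split; first by rewrite mul_ln_div_le ?x0 ?a0.
  by move=> e [|//] _; apply/esym/subr0_eq.
have [h1 h2] := IHj (ltnW jm).
rewrite big_ord_recr/= LS// mulrDr.
have h3 : x j.+1 * L j.+1 <= \sum_(i < j.+1) (a i - x i).
  by rewrite (le_trans _ h1)// ler_wpM2r ?L_ge0 ?xD// ltnW.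
split; first by rewrite lerD// mul_ln_div_le ?x0 ?a0.
move=> e; have ax : x j.+1 = a j.+1.
  apply/eqP/negPn/negP => ne.
  have := mul_ln_div_lt (x0 _ jm) (a0 _ jm) ne => /(ler_ltD h3).
  by rewrite e -mulrDr -LS// ltNge mulr_ge0 ?L_ge0// ltW ?x0.
move: e; rewrite ax subrr addr0 => /h2 {}h2 i.
by rewrite ltnS leq_eqVlt => /predU1P[->|/h2].
Qed.

Lemma sylvester_tE n : sylvester_t n = (\prod_(i < n) sylvester i)%N.
Proof. by rewrite /sylvester_t sylvesterE addKn. Qed.

Lemma sylvester_gt0 n : (0 < sylvester n)%N.
Proof. by rewrite sylvesterE. Qed.

Lemma sylvester_t_gt0 n : (0 < sylvester_t n)%N.
Proof. by rewrite sylvester_tE prodn_gt0// => i; exact: sylvester_gt0. Qed.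

Lemma sylvester_tS n : sylvester_t n.+1 = (sylvester_t n * sylvester n)%N.
Proof. by rewrite !sylvester_tE big_ord_recr. Qed.

Lemma sylvesterSt n : sylvester n = (sylvester_t n).+1.
Proof. by rewrite sylvester_tE sylvesterE. Qed.

(** Telescoping: [t_(n+1) = t_n * (t_n + 1)] gives [1 / y_n = 1 / t_n - 1 / t_(n+1)]. *)
Lemma sum_inv_sylvester n :
  \sum_(i < n) (sylvester i)%:R^-1 = 1 - (sylvester_t n)%:R^-1 :> R.
Proof.
elim: n => [|n IHn]; first by rewrite big_ord0 sylvester_tE big_ord0 invr1 subrr.
rewrite big_ord_recr/= IHn sylvester_tS sylvesterSt natrM.
have t0 : (sylvester_t n)%:R != 0 :> R by rewrite pnatr_eq0 -lt0n sylvester_t_gt0.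
by rewrite -natr1; field; rewrite t0 natr1 pnatr_eq0.
Qed.

(** Multiplied by [prod k_i], the right-hand side is a positive integer. *)
Lemma prod_inv_le_sub_sum_inv k n : (forall i, (0 < k i)%N) ->
  \sum_(i < n) (k i)%:R^-1 < 1 :> R ->
  \prod_(i < n) (k i)%:R^-1 <= 1 - \sum_(i < n) (k i)%:R^-1 :> R.
Proof.
move=> k0 s1.
have K0 : 0 < \prod_(i < n) (k i)%:R :> R by apply: prodr_gt0 => i _; rewrite ltr0n.
have [z zE] : exists z : int,
    \prod_(i < n) (k i)%:R * (1 - \sum_(i < n) (k i)%:R^-1) = z%:~R :> R.
  elim: n {s1 K0} => [|n [z zE]]; first by exists 1; rewrite !big_ord0 subr0 mulr1.
  exists (z * (k n)%:Z - (\prod_(i < n) k i)%N%:Z).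
  rewrite intrD intrM -zE rmorphN /= !big_ord_recr /= -natr_prod.
  have kn0 : (k n)%:R != 0 :> R by rewrite pnatr_eq0 -lt0n.
  by field.
rewrite prodfV -(ler_pM2l K0) divff ?gt_eqF// zE.
have : 0 < z%:~R :> R by rewrite -zE mulr_gt0// subr_gt0.
by rewrite ltr0z gtz0_ge1 -(ler_int R).
Qed.

Section Extremal.
Variables (n : nat) (k : nat -> nat).
Hypothesis k_gt0 : forall i, (0 < k i)%N.
Hypothesis k_mono : forall i, (i < n)%N -> (k i <= k i.+1)%N.
Hypothesis sum_k : \sum_(i < n.+1) (k i)%:R^-1 = 1 :> R.

Let x i : R := (k i)%:R^-1.
(** The claimed extremal partition; its last entry [1 / t_n] is exactly what the first [n] Sylvester
    fractions leave of 1. *)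
Let a i : R := if (i < n)%N then (sylvester i)%:R^-1 else (sylvester_t n)%:R^-1.
Let X j := \prod_(i < j) x i.
Let A j := \prod_(i < j) a i.

Let x_gt0 i : 0 < x i. Proof. by rewrite invr_gt0 ltr0n. Qed.
Let a_gt0 i : 0 < a i.
Proof.
by rewrite /a; case: ifP => _; rewrite invr_gt0 ltr0n ?sylvester_gt0 ?sylvester_t_gt0.
Qed.
Let X_gt0 j : 0 < X j. Proof. exact: prodr_gt0. Qed.
Let A_gt0 j : 0 < A j. Proof. exact: prodr_gt0. Qed.

Let A_E j : (j <= n)%N -> A j = (sylvester_t j)%:R^-1.
Proof.
move=> jn; rewrite sylvester_tE natr_prod -prodfV; apply: eq_bigr => i _.
by rewrite /a (leq_trans (ltn_ord i) jn).
Qed.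

(** Equality case of [prod_inv_le_sub_sum_inv]: for [a] the remainder of each such initial sum is
    the product, whereas [X_le] gives only an inequality for [x]. *)
Let sum_a j : (j <= n)%N -> \sum_(i < j) a i = 1 - A j.
Proof.
move=> jn; rewrite A_E// -sum_inv_sylvester; apply: eq_bigr => i _.
by rewrite /a (leq_trans (ltn_ord i) jn).
Qed.

Let sum_aS : \sum_(i < n.+1) a i = 1.
Proof. by rewrite big_ord_recr/= sum_a// A_E// /a ltnn subrK. Qed.

Let A_S : A n.+1 = A n ^+ 2.
Proof. by rewrite /A big_ord_recr/= -/(A n) A_E// /a ltnn expr2. Qed.

Let X_le j : (j <= n)%N -> X j <= 1 - \sum_(i < j) x i.
Proof.
move=> jn; apply: prod_inv_le_sub_sum_inv => //; rewrite -[ltRHS]sum_k.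
rewrite -(subnKC (leqW jn)) big_split_ord/= ltrDl subSn// big_ord_recl.
by rewrite ltr_pwDl ?invr_gt0 ?ltr0n// sumr_ge0.
Qed.

Let x_noninc i : (i < n)%N -> x i.+1 <= x i.
Proof. by move=> i_n; rewrite /x lef_pV2 ?posrE ?ltr0n// ler_nat k_mono. Qed.

(** Dividing [X (j + i) <= A (j + i)] by the initial products with [A j <= X j] bounds the tail
    products of [x] by those of [a], so [log_majorization] applies from [j] on. *)
Let tail j r : (j + r <= n.+1)%N -> A j <= X j ->
  (forall i, (j < i <= j + r)%N -> X i <= A i) ->
  \sum_(i < r) x (j + i)%N <= \sum_(i < r) a (j + i)%N /\
  (\sum_(i < r) x (j + i)%N = \sum_(i < r) a (j + i)%N ->
   forall i, (i < r)%N -> x (j + i)%N = a (j + i)%N).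
Proof.
move=> jr AXj XA.
apply: (log_majorization (x := fun i => x (j + i)%N) (a := fun i => a (j + i)%N)) => //.
  by move=> i ir; rewrite addnS x_noninc//; lia.
move=> [|i] ir; first by rewrite !big_ord0.
have : X (j + i.+1)%N <= A (j + i.+1)%N by apply: XA; lia.
rewrite /X /A !big_split_ord/= -/(X j) -/(A j) => XAi.
rewrite -(ler_pM2l (X_gt0 j)) (le_trans XAi)//.
by rewrite ler_wpM2r// ltW// prodr_gt0.
Qed.

(** Index 0 qualifies, both products being empty. Beyond the last such index the reverse inequality
    holds, which is the hypothesis of [tail]. *)
Let last_ge m : (0 < m)%N -> exists2 j, (j < m)%N /\ A j <= X j &
  forall i, (j < i < m)%N -> X i <= A i.
Proof.
move=> m0; have exP : exists j, (j < m)%N && (A j <= X j).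
  by exists 0%N; rewrite m0 /A /X !big_ord0/=.
have ub j : (j < m)%N && (A j <= X j) -> (j <= m)%N by case/andP => /ltnW.
case: (ex_maxnP exP ub) => j /andP[jm AXj] jmax; exists j => // i /andP[ji im].
rewrite leNgt; apply/negP => /ltW AXi; have := jmax i; rewrite im AXi/= leqNgt ji.
by move/(_ isT).
Qed.

(** With [j] from [last_ge], [tail] gives [1 - \sum_(i < j) x i <= A j <= X j], and [X_le] closes
    the circle. So the tails agree, and the hypotheses hold again at the smaller index [j]. *)
Let prefix_eq m : (m <= n)%N -> X m = A m -> \sum_(i < m) x i = 1 - A m ->
  forall i, (i < m)%N -> x i = a i.
Proof.
elim/ltn_ind: m => -[//|m] IHm mn XAm sxm.
have [j [jm AXj] XA] := last_ge (ltn0Sn m).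
have [r Er] : exists r, m.+1 = (j + r)%N by exists (m.+1 - j)%N; rewrite subnKC// ltnW.
have jn : (j <= n)%N by rewrite (leq_trans (ltnW jm)).
have [||le eq] := @tail j r _ AXj.
- by rewrite -Er ltnW.
- move=> i /andP[ji]; rewrite -Er leq_eqVlt => /predU1P[->|im]; first by rewrite XAm.
  by rewrite XA// ji.
have split (f : nat -> R) :
    \sum_(i < m.+1) f i = \sum_(i < j) f i + \sum_(i < r) f (j + i)%N.
  by rewrite Er big_split_ord.
have sumx : \sum_(i < r) x (j + i)%N = 1 - A m.+1 - \sum_(i < j) x i.
  by rewrite -sxm split addrAC subrr add0r.
have suma : \sum_(i < r) a (j + i)%N = A j - A m.+1.
  by have := sum_a mn; rewrite split sum_a// => e; lra.
have lXj := X_le jn.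
have eXj : X j = A j by apply/eqP; move: le; rewrite sumx suma => le; rewrite eq_le AXj andbT; lra.
have esj : \sum_(i < j) x i = 1 - A j by move: le; rewrite sumx suma => le; lra.
have {}eq := eq (ltac:(rewrite sumx suma esj; ring)).
move=> i im; have [ij|ji] := ltnP i j; first exact: (IHm j jm jn eXj esj i ij).
by rewrite -(subnKC ji) eq//; lia.
Qed.

(** If [j] is the last index with [A j <= X j], then [tail] bounds the sum of the [x_i]
    from [j] on by that of the [a_i], which is [A j <= X j]; but by [X_le] it is at least
    [X j], so the two tails agree. *)
Lemma unit_fraction_extremal : (sylvester_t n ^ 2 <= \prod_(i < n.+1) k i)%N ->
  forall i, (i <= n)%N -> k i = if (i < n)%N then sylvester i else sylvester_t n.
Proof.
move=> tk.
have XAS : X n.+1 <= A n.+1.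
  rewrite A_S A_E// /X prodfV -natr_prod exprVn -natrX lef_pV2 ?posrE ?ltr0n ?ler_nat//.
    by rewrite prodn_gt0.
  by rewrite expn_gt0 sylvester_t_gt0.
have AXn : A n <= X n.
  have [j [jn AXj] XA] := last_ge (ltn0Sn n).
  move: jn; rewrite ltnS leq_eqVlt => /predU1P[<-//|jn].
  have [r Er] : exists r, n.+1 = (j + r.+1)%N by exists (n - j)%N; rewrite addnS subnKC// ltnW.
  have [||le eq] := @tail j r.+1 _ AXj; first by rewrite -Er.
    move=> i /andP[ji]; rewrite -Er leq_eqVlt => /predU1P[->//|im].
    by rewrite XA// ji.
  have split (f : nat -> R) :
      \sum_(i < n.+1) f i = \sum_(i < j) f i + \sum_(i < r.+1) f (j + i)%N.
    by rewrite Er big_split_ord.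
  have sumx : \sum_(i < r.+1) x (j + i)%N = 1 - \sum_(i < j) x i.
    by have := sum_k; rewrite (split x) => <-; rewrite addrAC subrr add0r.
  have suma : \sum_(i < r.+1) a (j + i)%N = A j.
    by have := sum_aS; rewrite split sum_a ?(ltnW jn)// => e; lra.
  have lXj := X_le (ltnW jn).
  have XAj : X j = A j.
    by apply/eqP; move: le; rewrite sumx suma => le; rewrite eq_le AXj andbT; lra.
  have {}eq : forall i, (i < r.+1)%N -> x (j + i)%N = a (j + i)%N.
    by apply: eq; rewrite sumx suma; move: le; rewrite sumx suma => le; lra.
  move: Er; rewrite addnS => -[Er]; rewrite /A /X Er !big_split_ord/= -/(X j) -/(A j) XAj.
  rewrite le_eqVlt; apply/predU1P; left; congr (_ * _).
  by apply: eq_bigr => i _; rewrite eq// ltnS ltnW.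
have xnE : x n = 1 - \sum_(i < n) x i.
  by rewrite -sum_k big_ord_recr/= addrAC subrr add0r.
(* The last fraction is the remainder, hence at least [X n], so [X n ^+ 2 <= X n.+1 <= A n ^+ 2].
   With [AXn] this pins down [X n], then [x n], and leaves an instance of [prefix_eq]. *)
have Xn : X n <= x n by rewrite xnE X_le.
have XS : X n.+1 = X n * x n by rewrite /X big_ord_recr.
have XAn : X n = A n.
  have : X n ^+ 2 <= A n ^+ 2.
    by rewrite -A_S (le_trans _ XAS)// XS expr2 ler_wpM2l// ltW.
  rewrite ler_sqr ?nnegrE ?(ltW (X_gt0 n)) ?(ltW (A_gt0 n))// => XAn.
  by apply/eqP; rewrite eq_le XAn.
have xA : x n = A n.
  apply/eqP; rewrite eq_le -{2}XAn Xn andbT -(ler_pM2l (A_gt0 n)).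
  by rewrite -{1}XAn -XS -expr2 -A_S.
have xa i : (i <= n)%N -> x i = a i.
  rewrite leq_eqVlt => /predU1P[->|i_n]; first by rewrite xA A_E// /a ltnn.
  by apply: (prefix_eq (leqnn n) XAn) => //; rewrite -xA xnE opprB addrC subrK.
move=> i /xa; rewrite /x /a; case: ifP => _ /invr_inj/eqP; rewrite eqr_nat => /eqP //.
Qed.

End Extremal.
End UnitFractions.

(** * Polar pairs of simplices *)

Section Hull.
Variables (R : realType) (d : nat).

Lemma convex_combination (X : set 'rV[R]_d) n (l : 'I_n -> R) (p : 'I_n -> 'rV[R]_d) :
  @convex_set R 'rV[R]_d X -> (forall i, X (p i)) -> (forall i, 0 <= l i) ->
  \sum_i l i = 1 -> X (\sum_i l i *: p i).
Proof.
move=> cX; elim: n => [|n IHn] in l p *.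
  by rewrite big_ord0 => _ _ /esym/eqP; rewrite oner_eq0.
move=> Xp l0; rewrite !big_ord_recl.
set s := \sum_(i < n) _ => sE.
have s0 : 0 <= s by rewrite sumr_ge0.
have l1 : l 0 <= 1 by rewrite -sE lerDl.
have [s_eq0|s_neq0] := eqVneq s 0.
  have l'0 i : l (lift 0 i) = 0 by move/psumr_eq0P: s_eq0; apply.
  rewrite big1 => [|i _]; last by rewrite l'0 scale0r.
  by move: sE; rewrite s_eq0 !addr0 => ->; rewrite scale1r.
have Xy : X (\sum_(i < n) (l (lift 0 i) / s) *: p (lift 0 i)).
  by apply: IHn => // [i|]; rewrite ?divr_ge0// -mulr_suml divff.
have /set_mem := cX _ _ (Itv01 (l0 0) l1) (mem_set (Xp 0)) (mem_set Xy).
congr X; rewrite /conv/=; congr (_ + _); rewrite scaler_sumr; apply: eq_bigr => i _.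
rewrite scalerA; congr (_ *: _); rewrite -[X in X * _]/(1 - l 0) -sE addrAC subrr add0r.
by rewrite mulrCA divff// mulr1.
Qed.

Lemma convex_hull n (V : 'M[R]_(n, d)) : @convex_set R 'rV[R]_d (hull V).
Proof.
move=> _ _ t /set_mem[l [l0 l1 ->]] /set_mem[m [m0 m1 ->]]; apply/mem_set.
exists (t%:num *: l + (1 - t%:num) *: m); split=> [i||].
- by rewrite !mxE addr_ge0// mulr_ge0// subr_ge0.
- under eq_bigr do rewrite !mxE.
  by rewrite big_split/= -!mulr_sumr l1 m1 !mulr1 addrC subrK.
- by rewrite mulmxDl -!scalemxAl.
Qed.

Lemma hull_row n (V : 'M[R]_(n, d)) i : hull V (row i V).
Proof.
exists (delta_mx 0 i); split=> [j||]; first by rewrite mxE ler0n.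
  rewrite (bigD1 i)//= mxE !eqxx big1 ?addr0// => j ji.
  by rewrite mxE (negbTE ji) andbF.
by rewrite -rowE.
Qed.

Lemma conv_hullE n (V : 'M[R]_(n, d)) : conv_hull (range (fun i => row i V)) = hull V.
Proof.
apply/seteqP; split.
  by apply: smallest_sub; [exact: convex_hull | move=> _ [i _ <-]; exact: hull_row].
move=> _ [l [l0 l1 ->]] X [cX rX]; rewrite mulmx_sum_row.
by apply: convex_combination => // i; apply: rX; exists i.
Qed.

Lemma pairingE (x y : 'rV[R]_d) : pairing x y = (x *m y^T) 0 0.
Proof. by rewrite mxE; apply: eq_bigr => i _; rewrite mxE. Qed.

Lemma pairingC (x y : 'rV[R]_d) : pairing x y = pairing y x.
Proof. by apply: eq_bigr => i _; rewrite mulrC. Qed.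

Lemma pairing_hull n (V : 'M[R]_(n, d)) (l : 'rV[R]_n) u :
  pairing (l *m V) u = \sum_i l 0 i * pairing (row i V) u.
Proof.
by rewrite pairingE -mulmxA mxE; apply: eq_bigr => i _; rewrite pairingE -row_mul [in RHS]mxE.
Qed.

(** A functional that attains its minimum only at [x] attains it at every row of positive weight in
    [x], so such a row is [x]. *)
Lemma vertices_hull_sub n (V : 'M[R]_(n, d)) :
  vertices (hull V) `<=` range (fun i => row i V).
Proof.
move=> x [u [c [uge F]]].
have [[l [l0 l1 xE]] xc] : hull V x /\ pairing x u = c.
  by have : [set x] x by []; rewrite F.
have [i li] : exists i, 0 < l 0 i.
  apply: contrapT => /forallNP l_le0; have : \sum_i l 0 i = 0.
    apply: big1 => i _; apply/eqP; rewrite eq_le l0 andbT leNgt; exact/negP.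
  by rewrite l1 => /eqP; rewrite oner_eq0.
exists i => //; have : [set x] (row i V); last by [].
rewrite F; split; first exact: hull_row.
have : \sum_j l 0 j * (pairing (row j V) u - c) = 0.
  under eq_bigr do rewrite mulrBr.
  by rewrite sumrB -pairing_hull -xE xc -mulr_suml l1 mul1r subrr.
move/psumr_eq0P => /(_ _ i isT)/eqP; rewrite mulf_eq0 gt_eqF//= subr_eq0 => H; apply/eqP/H.
by move=> j _; rewrite mulr_ge0// subr_ge0; apply: uge; exact: hull_row.
Qed.

End Hull.

Section Polar.
Variables (R : realType) (d : nat).
Implicit Types (V W : 'M[R]_(d.+1, d)) (k : 'rV[R]_d.+1).

(** With [v_i], [w_j] the rows of [V], [W], this says that
    [<v_i, w_j> = k_i delta_ij - 1]. *)
Definition polar_pair V W k :=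
  (forall i, 0 < k 0 i) /\ homog V *m (homog W)^T = diag_mx k.

Lemma polar_pair_sym V W k : polar_pair V W k -> polar_pair W V k.
Proof.
by move=> [k0 VW]; split=> //; rewrite -[LHS]trmxK trmx_mul trmxK VW tr_diag_mx.
Qed.

Lemma polar_pairing V W k i j : polar_pair V W k ->
  pairing (row i V) (row j W) = k 0 i *+ (i == j) - 1.
Proof.
move=> [_ /matrixP/(_ i j)]; rewrite /homog tr_row_mx mul_row_col !mxE.
rewrite big_ord1 !mxE mulr1 => <-; rewrite addrAC subrr add0r.
by apply: eq_bigr => l _; rewrite !mxE.
Qed.

Definition inv_row k : 'rV[R]_d.+1 := \row_i (k 0 i)^-1.

Lemma polar_inv V W k : polar_pair V W k ->
  (homog W)^T *m diag_mx (inv_row k) *m homog V = 1%:M.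
Proof.
move=> [k0 VW]; rewrite -mulmxA; apply: mulmx1C; rewrite -mulmxA VW mulmx_diag.
apply/matrixP => i j; rewrite !mxE; case: eqP => [->|]//.
by rewrite mulVf ?gt_eqF.
Qed.

(** Both claims are the first row of the identity [polar_inv], because the first row of
    [(homog W)^T] consists of ones. *)
Lemma polar_bary V W k : polar_pair V W k ->
  \sum_i (k 0 i)^-1 = 1 /\ inv_row k *m V = 0.
Proof.
move=> /polar_inv; rewrite /homog tr_row_mx mul_col_mx mul_col_row scalar_mx_block.
case/eq_block_mx => e1 e2 _ _.
have cE : (const_mx 1)^T *m diag_mx (inv_row k) = inv_row k.
  by apply/rowP => i; rewrite mul_mx_diag !mxE mul1r.
split; last by rewrite -e2 cE.
move/matrixP/(_ 0 0): e1; rewrite cE !mxE => e; rewrite -[RHS]e; apply: eq_bigr => i _.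
by rewrite !mxE mulr1.
Qed.

Lemma polar_homog_unit V W k : polar_pair V W k -> homog V \in unitmx.
Proof. by move/polar_inv/mulmx1_unit => []. Qed.

Lemma polar_det V W k : polar_pair V W k ->
  \det (homog V) * \det (homog W) = \prod_i k 0 i.
Proof. by move=> [_ /(congr1 determinant)]; rewrite det_mulmx det_tr det_diag. Qed.

Lemma Vol_hull V W k : polar_pair V W k ->
  Vol (hull V) = `|\det (homog V)|%:E.
Proof.
by move=> /polar_homog_unit uV; rewrite /Vol volume_hull// -EFinM mulrCA divff ?mulr1//.
Qed.

Lemma pairing_row_hull V W k (l : 'rV[R]_d.+1) j : polar_pair V W k ->
  pairing (l *m V) (row j W) = k 0 j * l 0 j - \sum_i l 0 i.
Proof.
move=> VW; rewrite pairing_hull.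
under eq_bigr do rewrite (polar_pairing _ _ VW) mulrBr mulr1.
rewrite sumrB (bigD1 j)//= eqxx big1 ?addr0 1?mulrC// => i ij.
by rewrite (negbTE ij) mulr0.
Qed.

(** Pairing the combination with [row j W] isolates the coefficient [l 0 j]. *)
Lemma polar_bary_uniq V W k (l : 'rV[R]_d.+1) : polar_pair V W k ->
  l *m V = 0 -> \sum_i l 0 i = 1 -> l = inv_row k.
Proof.
move=> VW lV l1; apply/rowP => j; have := pairing_row_hull l j VW.
have k0 := proj1 VW j; rewrite lV l1 mxE {1}/pairing big1 => [/esym/eqP|i _].
  by rewrite subr_eq0 => /eqP e; rewrite -[LHS]mul1r -(mulVf (lt0r_neq0 k0)) -mulrA e mulr1.
by rewrite mxE mul0r.
Qed.

Lemma polar_row_inj V W k : polar_pair V W k -> injective (fun i => row i V).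
Proof.
move=> VW i j /= eV; have k0 := proj1 VW i.
have := polar_pairing i i VW; rewrite {1}eV (polar_pairing _ _ VW) eqxx.
by case: eqP => // _ /addIr/esym/eqP; rewrite gt_eqF.
Qed.

Lemma polar_dual V W k : polar_pair V W k -> dual_polytope (hull V) = hull W.
Proof.
move=> VW; have WV := polar_pair_sym VW; apply/seteqP; split=> x.
  move=> xP; have x_ge i : 0 <= 1 + pairing (row i V) x.
    by rewrite -lerBlDl sub0r; apply: xP; exact: hull_row.
  (* The barycentric coordinates of [x] with respect to [W]; their nonnegativity is the defining
     inequality of the dual at the vertex [row i V]. *)
  pose m := \row_i ((1 + pairing (row i V) x) / k 0 i).
  have mE : m *m homog W = row_mx 1%:M x.
    have uV : (homog V)^T \in unitmx by rewrite unitmx_tr (polar_homog_unit VW).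
    rewrite -[LHS](mulmxK uV) -[RHS](mulmxK uV); congr (_ *m _).
    rewrite -mulmxA (proj2 WV) mul_mx_diag /homog tr_row_mx mul_row_col mul1mx.
    apply/rowP => i; rewrite !mxE divfK ?gt_eqF// ?(proj1 VW)//; congr (_ + _).
    by apply: eq_bigr => j _; rewrite !mxE mulrC.
  move: mE; rewrite /homog mul_mx_row => /eq_row_mx[m1 mx].
  exists m; split=> // [i|]; first by rewrite mxE divr_ge0// ltW// (proj1 VW).
  move/matrixP/(_ 0 0): m1; rewrite !mxE mulr1n => <-.
  by apply: eq_bigr => i _; rewrite !mxE mulr1.
move: x => _ [l [l0 l1 ->]] _ [m [m0 m1 ->]].
rewrite pairing_hull -m1 -sumrN; apply: ler_sum => i _.
rewrite -[leLHS]mulr1 mulNr -mulrN ler_wpM2l// pairingC.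
by rewrite (pairing_row_hull _ _ WV) l1 -lerBlDr subrr mulr_ge0// ltW// (proj1 VW).
Qed.

(** On a point with barycentric coordinates [l] the functional [- row i W] takes the value
    [1 - k_i * l_i], which is minimal only where [l_i = 1]. *)
Lemma polar_vertices V W k : polar_pair V W k ->
  vertices (hull V) = range (fun i => row i V).
Proof.
move=> VW; apply/seteqP; split; first exact: vertices_hull_sub.
move=> _ [i _ <-]; have k0 := proj1 VW i.
have le1 (l : 'rV[R]_d.+1) : (forall i, 0 <= l 0 i) -> \sum_i l 0 i = 1 -> l 0 i <= 1.
  by move=> l0 <-; rewrite (bigD1 i)//= lerDl sumr_ge0.
have pE (l : 'rV[R]_d.+1) : \sum_i l 0 i = 1 ->
    pairing (l *m V) (- row i W) = 1 - k 0 i * l 0 i.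
  move=> l1; have := pairing_row_hull l i VW; rewrite l1 => e.
  rewrite -opprB -e /pairing -sumrN; apply: eq_bigr => j _.
  by rewrite [X in _ * X = _]mxE mulrN.
exists (- row i W), (1 - k 0 i); split.
  move=> _ [l [l0 l1 ->]]; rewrite pE// lerD2l lerN2 -[leRHS]mulr1 ler_pM2l//.
  exact: le1.
apply/seteqP; split=> x /=.
  move=> ->; split; first exact: hull_row.
  have [l [l0 l1 e]] := hull_row V i; rewrite e pE//; congr (_ - _).
  have := pairing_row_hull l i VW; rewrite -e (polar_pairing _ _ VW) eqxx l1.
  by move/addIr.
case=> -[l [l0 l1 ->]]; rewrite pE// => /addrI/oppr_inj e.
have li : l 0 i = 1 by apply: (mulfI (lt0r_neq0 k0)); rewrite e mulr1.
rewrite rowE; congr (_ *m V); apply/rowP => j; rewrite mxE eqxx/=.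
have [->//|ji] := eqVneq j i; move: l1; rewrite (bigD1 i)//= li -[RHS]addr0 => /addrI.
by move/psumr_eq0P => /(_ (fun i _ => l0 i)) ->.
Qed.

End Polar.

(** * From reflexive simplices to integral polar pairs *)

Section ReflexiveSimplex.
Variables (R : realType) (d : nat).

Lemma aff_hull n (V : 'M[R]_(n, d)) : aff (hull V) `<=`
  [set x | exists2 l : 'rV[R]_n, \sum_i l 0 i = 1 & x = l *m V].
Proof.
move=> _ [m [w [p [pP w1 ->]]]].
have /choice[l lP] : forall i, exists l : 'rV[R]_n, \sum_j l 0 j = 1 /\ p i = l *m V.
  by move=> i; have [l [_ l1 pE]] := pP i; exists l.
exists (\sum_i w i *: l i).
  under eq_bigr do rewrite summxE.
  rewrite exchange_big/= -w1; apply: eq_bigr => i _.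
  by under eq_bigr do rewrite mxE; rewrite -mulr_sumr (proj1 (lP i)) mulr1.
rewrite mulmx_suml; apply: eq_bigr => i _.
by rewrite (proj2 (lP i)) scalemxAl.
Qed.

Lemma full_dim_row_full n (V : 'M[R]_(n, d)) : full_dim (hull V) -> row_full (homog V).
Proof.
move=> fV; have affV (x : 'rV[R]_d) : (row_mx 1%:M x <= homog V)%MS.
  have [l l1 ->] : exists2 l : 'rV[R]_n, \sum_i l 0 i = 1 & x = l *m V.
    by apply: aff_hull; rewrite fV.
  apply/submxP; exists l; rewrite /homog mul_mx_row; congr (row_mx _ _).
  apply/matrixP => i j; rewrite !ord1 !mxE mulr1n -[LHS]l1.
  by apply: eq_bigr => p _; rewrite mxE mulr1.
rewrite -sub1mx; apply/row_subP => i; set r := row i _.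
rewrite -(hsubmxK r) (mx11_scalar (lsubmx r)); set c := lsubmx r 0 0.
have -> : row_mx c%:M (rsubmx r) = c *: row_mx 1%:M 0 +
    (row_mx 1%:M (rsubmx r) - row_mx 1%:M 0).
  rewrite scale_row_mx scaler0 scale_scalar_mx mulr1 opp_row_mx !add_row_mx.
  by rewrite subrr subr0 addr0 add0r.
by rewrite addmx_sub ?scalemx_sub ?addmx_sub ?eqmx_opp.
Qed.

Lemma aff_indep_row_free n (V : 'M[R]_(n, d)) :
  aff_indep (fun i => row i V) -> row_free (homog V).
Proof.
move=> aV; rewrite -kermx_eq0; apply/eqP/row_matrixP => i; rewrite row0.
set l := row i _; have : l *m homog V = 0 by apply/sub_kermxP; exact: row_sub.
rewrite /homog mul_mx_row => /eqP; rewrite row_mx_eq0 => /andP[/eqP l1 /eqP lV].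
apply/rowP => j; rewrite [RHS]mxE; apply: (aV (fun j => l 0 j)).
  move/matrixP/(_ 0 0): l1; rewrite !mxE => e; rewrite -[RHS]e.
  by apply: eq_bigr => p _; rewrite !mxE mulr1.
by rewrite -mulmx_sum_row.
Qed.

(** A small multiple [- (e / 2) *: row i V] stays in the hull. Adding [e / 2] to its weight at [i]
    represents the origin with total weight [1 + e / 2] and positive weight at [i]. *)
Lemma interior_bary_gt0 (V : 'M[R]_(d.+1, d)) : homog V \in unitmx ->
  interior (hull V) 0 ->
  exists b : 'rV[R]_d.+1, (forall i, 0 < b 0 i) /\ b *m homog V = row_mx 1%:M 0.
Proof.
move=> uV int0.
pose b : 'rV[R]_d.+1 := (row_mx 1%:M 0 : 'rV[R]_(1 + d)) *m invmx (homog V : 'M[R]_d.+1).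
have bV : b *m homog V = row_mx 1%:M 0 by rewrite mulmxKV.
exists b; split=> // i.
have : \forall t \near (0 : R), hull V (t *: row i V).
  have : (t *: row i V) @[t --> (0 : R)] --> (0 : 'rV[R]_d).
    by rewrite -[X in _ --> X](scale0r (row i V)); apply: scalel_continuous.
  exact.
move=> /nbhs_ballP[e /= e0 eP].
have [l [l0 l1 lE]] : hull V (- (e / 2) *: row i V).
  apply: eP; rewrite /ball/= sub0r opprK gtr0_norm ?divr_gt0//.
  by rewrite ltr_pdivrMr// ltr_pMr// ltr1n.
pose m := l + (e / 2) *: delta_mx 0 i.
have e2 : 0 < e / 2 by rewrite divr_gt0.
have mV : m *m homog V = (1 + e / 2) *: row_mx 1%:M 0.
  rewrite /m mulmxDl -scalemxAl -rowE /homog mul_mx_row -lE row_row_mx.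
  rewrite scale_row_mx add_row_mx scale_row_mx scaler0 scaleNr addNr; congr row_mx.
  apply/matrixP => p q; rewrite !ord1 !mxE mulr1n !mulr1; congr (_ + _); rewrite -[RHS]l1.
  by apply: eq_bigr => j _; rewrite mxE mulr1.
have mE : m = (1 + e / 2) *: b.
  by apply: (can_inj (mulmxK uV)); rewrite mV -scalemxAl bV.
have : 0 < m 0 i by rewrite !mxE !eqxx mulr1 ltr_wpDl.
by rewrite mE mxE pmulr_rgt0// addr_gt0.
Qed.

Lemma polar_of_bary (V : 'M[R]_(d.+1, d)) (b : 'rV[R]_d.+1) : homog V \in unitmx ->
  (forall i, 0 < b 0 i) -> b *m homog V = row_mx 1%:M 0 ->
  (* Solving the polar identity for [(homog W)^T] leaves no choice but [X] below. It has the
     required shape because [b *m homog V = (1, 0)] makes its first row constant 1. *)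
  exists W, polar_pair V W (inv_row b).
Proof.
move=> uV b0 bV; pose X := invmx (homog V) *m diag_mx (inv_row b).
have X1 : usubmx (X : 'M[R]_(1 + d, d.+1)) = const_mx 1.
  have -> : usubmx (X : 'M[R]_(1 + d, d.+1)) = (row_mx 1%:M 0 : 'rV[R]_(1 + d)) *m X.
    by rewrite -{2}(vsubmxK (X : 'M[R]_(1 + d, d.+1))) mul_row_col mul1mx mul0mx addr0.
  rewrite -bV mulmxA mulmxK// mul_mx_diag; apply/rowP => i.
  by rewrite !mxE divff// gt_eqF.
exists (dsubmx (X : 'M[R]_(1 + d, d.+1)))^T; split=> [i|]; first by rewrite mxE invr_gt0.
rewrite /homog tr_row_mx trmxK trmx_const -X1 vsubmxK -/(homog V) mulKVmx//.
Qed.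

Lemma lattice_rows (V : 'M[R]_(d.+1, d)) :
  range (fun i => row i V) `<=` lattice R d -> V \is a mxOver Num.int.
Proof.
move=> VL; apply/mxOverP => i j.
by have /mxOverP/(_ 0 j) := VL _ (ex_intro2 _ _ i I erefl); rewrite mxE.
Qed.

Lemma pairing_int (x y : 'rV[R]_d) : x \is a mxOver Num.int -> y \is a mxOver Num.int ->
  pairing x y \is a Num.int.
Proof.
move=> /mxOverP xi /mxOverP yi; apply: rpred_sum => i _.
by rewrite rpredM.
Qed.

Lemma reflexive_simplex_polar (P : set 'rV[R]_d) : reflexive_polytope P -> simplex P ->
  exists V W (k : 'I_d.+1 -> nat), [/\ P = hull V, polar_pair V W (\row_i (k i)%:R),
    V \is a mxOver Num.int & W \is a mxOver Num.int].
Proof.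
move=> [[_ vP] fP iP [_ vP']] [n [v [av PE]]].
pose V := \matrix_i v i.
have rV i : row i V = v i by rewrite rowK.
have {}PE : P = hull V.
  by rewrite PE -conv_hullE; congr conv_hull; apply: eq_imagel => i _; rewrite rV.
have rf : row_full (homog V) by apply: full_dim_row_full; rewrite -PE.
have rr : row_free (homog V).
  by apply: aff_indep_row_free; move: av; congr aff_indep; apply/funext => i.
(* Full dimension and affine independence make [homog V] both row-full and row-free, hence
   square. *)
have nd : n = d by move: rf rr; rewrite /row_full /row_free => /eqP -> /eqP[].
subst n; have uV : homog V \in unitmx by rewrite -row_full_unit.
move: iP; rewrite PE => iP; have [b [b0 bV]] := interior_bary_gt0 uV iP.
have [W VW] := polar_of_bary uV b0 bV.
have Vi : V \is a mxOver Num.int by apply: lattice_rows; rewrite -(polar_vertices VW) -PE.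
have Wi : W \is a mxOver Num.int.
  by apply: lattice_rows; rewrite -(polar_vertices (polar_pair_sym VW)) -(polar_dual VW) -PE.
(* Integrality of the weights: [k_i = <v_i, w_i> + 1]. *)
have /choice[k kE] : forall i, exists k : nat, inv_row b 0 i = k%:R.
  move=> i; apply/natrP; rewrite natrEint (ltW (proj1 VW i)) andbT.
  have := polar_pairing i i VW; rewrite eqxx mulr1n => e.
  rewrite -[inv_row b 0 i](subrK 1) -e.
  rewrite rpredD ?rpred1// pairing_int//.
  by apply/mxOverP => p q; rewrite mxE (mxOverP Vi).
  by apply/mxOverP => p q; rewrite mxE (mxOverP Wi).
exists V, W, k; split=> //; suff <- : inv_row b = \row_i (k i)%:R by [].
by apply/rowP => i; rewrite [RHS]mxE.
Qed.

End ReflexiveSimplex.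

(** * Integrality and lattice isomorphisms *)

Section IntegralMatrices.
Variable R : realType.

Lemma int_mxE m n (A : 'M[R]_(m, n)) : A \is a mxOver Num.int ->
  exists B : 'M[int]_(m, n), A = map_mx intr B.
Proof.
move=> /mxOverP Ai; exists (map_mx Num.floor A).
by apply/matrixP => i j; rewrite !mxE; apply/esym/eqP; rewrite -intrEfloor.
Qed.

Lemma det_int n (A : 'M[R]_n) : A \is a mxOver Num.int -> \det A \is a Num.int.
Proof. by move=> /int_mxE[B ->]; rewrite det_map_mx intr_int. Qed.

Lemma adj_int n (A : 'M[R]_n) i j : A \is a mxOver Num.int -> \adj A i j \is a Num.int.
Proof. by move=> /int_mxE[B ->]; rewrite -map_mx_adj mxE intr_int. Qed.

Lemma int_mul1_norm (x y : R) : x \is a Num.int -> y \is a Num.int -> `|x * y| = 1 ->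
  `|x| = 1.
Proof.
move=> /intrP[m ->] /intrP[n ->]; rewrite -intrM -!intr_norm => /eqP.
rewrite -[1]/(1%:~R) eqr_int normrM -!abszE -PoszM eqz_nat muln_eq1.
by case/andP => /eqP->.
Qed.

Lemma det_norm1_unitmx n (B : 'M[int]_n) :
  `|\det (map_mx intr B : 'M[R]_n)| = 1 -> B \in unitmx.
Proof.
rewrite det_map_mx -intr_norm unitmxE => /eqP.
rewrite -[1]/(1%:~R) eqr_int eqr_norml => /andP[/orP[]/eqP-> _].
  exact: unitr1.
exact: unitrN1.
Qed.

Lemma map_intr_unitmx n (B : 'M[int]_n) : B \in unitmx ->
  (map_mx intr B : 'M[R]_n) \in unitmx.
Proof.
move=> uB; have := congr1 (map_mx (intr : int -> R)) (mulmxV uB).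
by rewrite map_mxM map_mx1 => /mulmx1_unit[].
Qed.

Lemma homog_int n d (V : 'M[R]_(n, d)) : V \is a mxOver Num.int ->
  homog V \is a mxOver Num.int.
Proof.
move=> /mxOverP Vi; apply/mxOverP => i j; rewrite /homog.
by case: (split_ordP j) => p ->; rewrite ?row_mxEl ?row_mxEr// mxE rpred1.
Qed.

End IntegralMatrices.

Section LatticeIso.
Variables (R : realType) (d : nat).

Lemma face_image (P1 P2 F : set 'rV[R]_d) (U : 'M[R]_d) : U \in unitmx ->
  P2 = [set x *m U | x in P1] -> face P1 F -> face P2 [set x *m U | x in F].
Proof.
move=> uU -> [u [c [uc ->]]].
have pU (x : 'rV[R]_d) : pairing (x *m U) (u *m (invmx U)^T) = pairing x u.
  by rewrite !pairingE trmx_mul trmxK mulmxA mulmxK.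
exists (u *m (invmx U)^T), c; split=> [_ [x Px <-]|]; first by rewrite pU uc.
apply/seteqP; split=> [_ [x [Px xc] <-]|_ [[x Px <-]]].
  by split; [exists x | rewrite pU].
by rewrite pU => xc; exists x.
Qed.

Lemma image_mul_inv (A : set 'rV[R]_d) (U : 'M[R]_d) : U \in unitmx ->
  [set x *m invmx U | x in [set x *m U | x in A]] = A.
Proof.
move=> uU; apply/seteqP; split=> [_ [_ [x Ax <-] <-]|x Ax]; first by rewrite mulmxK.
by exists (x *m U); [exists x | rewrite mulmxK].
Qed.

Lemma image_mul_hull n (V : 'M[R]_(n, d)) (U : 'M[R]_d) :
  [set x *m U | x in hull V] = hull (V *m U).
Proof.
apply/seteqP; split=> [_ [_ [l [l0 l1 ->]] <-]|_ [l [l0 l1 ->]]].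
  by exists l; split=> //; rewrite mulmxA.
by exists (l *m V); [exists l | rewrite mulmxA].
Qed.

Lemma aff_hull_setT (V : 'M[R]_(d.+1, d)) : homog V \in unitmx -> aff (hull V) = setT.
Proof.
move=> uV; apply/seteqP; split=> // x _.
pose l : 'rV[R]_d.+1 := (row_mx 1%:M x : 'rV[R]_(1 + d)) *m invmx (homog V : 'M[R]_d.+1).
have : l *m homog V = row_mx 1%:M x by rewrite mulmxKV.
rewrite /homog mul_mx_row => /eq_row_mx[l1 lV].
exists d.+1, (fun i => l 0 i), (fun i => row i V); split=> [i||].
- exact: hull_row.
- move/matrixP/(_ 0 0): l1; rewrite !mxE => e; rewrite -[RHS]e.
  by apply: eq_bigr => i _; rewrite !mxE mulr1.
- by rewrite -mulmx_sum_row.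
Qed.

Lemma lattice_iso_unitmx (V1 V2 : 'M[R]_(d.+1, d)) (U : 'M[int]_d) :
  homog V1 \in unitmx -> homog V2 \in unitmx -> U \in unitmx ->
  V1 *m map_mx intr U = V2 -> lattice_iso (hull V1) (hull V2).
Proof.
move=> u1 u2 uU V12; exists U => //=.
have uUR : (map_mx intr U : 'M[R]_d) \in unitmx by exact: map_intr_unitmx.
have hE : hull V2 = [set x *m map_mx intr U | x in hull V1] by rewrite image_mul_hull V12.
split.
- rewrite !aff_hull_setT//; split=> // [x y _ _ /(can_inj (mulmxK uUR))//|y _].
  by exists (y *m invmx (map_mx intr U)) => //; rewrite mulmxKV.
- by move=> F; apply: face_image.
- move=> F' F'f; exists [set x *m invmx (map_mx intr U) | x in F'].
    apply: face_image F'f; first by rewrite unitmx_inv.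
    by rewrite hE image_mul_inv.
  by have := image_mul_inv F' (U := invmx (map_mx intr U)); rewrite invmxK unitmx_inv => ->.
Qed.

(** One-point faces correspond, so the map matches vertices. Being linear it fixes the origin and
    preserves its barycentric coordinates, the reciprocals of the weights; [l] below transports
    them. *)
Lemma lattice_iso_polar V1 W1 k1 V2 W2 k2 :
  @polar_pair R d V1 W1 k1 -> @polar_pair R d V2 W2 k2 ->
  lattice_iso (hull V1) (hull V2) ->
  exists s : 'S_d.+1, forall i, k1 0 (s i) = k2 0 i.
Proof.
move=> VW1 VW2 [U uU [_ _ ex_face]].
have uUR : (map_mx intr U : 'M[R]_d) \in unitmx by exact: map_intr_unitmx.
have /choice[f fE] : forall i, exists j, row i V2 = row j V1 *m map_mx intr U.
  move=> i; have : vertices (hull V2) (row i V2) by rewrite (polar_vertices VW2); exists i.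
  move=> /ex_face[F faceF rF].
  have [x Fx xE] : [set x *m map_mx intr U | x in F] (row i V2) by rewrite -rF.
  have : vertices (hull V1) x.
    rewrite /vertices/= (_ : [set x] = F)//; apply/seteqP; split=> [_ ->//|y Fy].
    apply: (can_inj (mulmxK uUR)); rewrite xE.
    by have : [set row i V2] (y *m map_mx intr U) by rewrite rF; exists y.
  by rewrite (polar_vertices VW1) => -[j _ jx]; exists j; rewrite jx.
have f_inj : injective f.
  by move=> i j fij; apply: (polar_row_inj VW2); rewrite /= !fE fij.
exists (perm f_inj) => i; rewrite permE.
pose l : 'rV[R]_d.+1 := \row_j (k2 0 (((perm f_inj)^-1)%g j))^-1.
have sum_l (G : 'I_d.+1 -> 'rV[R]_d) : \sum_j l 0 j *: G j = \sum_i (k2 0 i)^-1 *: G (f i).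
  rewrite (reindex_inj (@perm_inj _ (perm f_inj)))/=; apply: eq_bigr => j _.
  by rewrite mxE permK permE.
have [k2s k2V] := polar_bary VW2.
have lV : l *m V1 = 0.
  apply: (can_inj (mulmxK uUR)); rewrite mul0mx -k2V -mulmxA !mulmx_sum_row.
  by rewrite sum_l; apply: eq_bigr => j _; rewrite row_mul -fE mxE.
have l1 : \sum_j l 0 j = 1.
  rewrite -[RHS]k2s (reindex_inj (@perm_inj _ (perm f_inj)))/=; apply: eq_bigr => j _.
  by rewrite mxE permK.
have /rowP/(_ (f i)) := polar_bary_uniq VW1 lV l1.
by rewrite !mxE -{1}[f i](permE f_inj) permK => /invr_inj.
Qed.

(** By [polar_inv], the inverse of [homog V] is [(homog W)^T] with columns divided by the weights,
    and its first row is [1 / k_i]. *)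
Lemma polar_adj V W k i : @polar_pair R d V W k ->
  \adj (homog V : 'M[R]_d.+1) 0 i = \det (homog V) / k 0 i.
Proof.
move=> VW; have uV := polar_homog_unit VW.
have W1 : (homog W)^T 0 i = 1.
  by rewrite mxE /homog mxE; case: splitP => // j _; rewrite mxE.
have : (homog W)^T *m diag_mx (inv_row k) = invmx (homog V : 'M[R]_d.+1).
  by rewrite -[RHS]mul1mx -(polar_inv VW) mulmxK.
rewrite /invmx uV => /(congr1 ( *:%R (\det (homog V)))).
rewrite scalerA divrr -?unitmxE// scale1r => <-.
by rewrite mul_mx_diag [LHS]mxE [X in _ * X]mxE W1 mul1r [X in _ * X]mxE.
Qed.

Lemma polar_det_dvd V W k i : @polar_pair R d V W k -> V \is a mxOver Num.int ->
  \det (homog V) / k 0 i \is a Num.int.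
Proof. by move=> VW Vi; rewrite -(polar_adj _ VW); apply: adj_int; exact: homog_int. Qed.

(** The cofactor at the last entry of the column of ones is, up to sign, the determinant of the
    first [d] vertices; [polar_adj] evaluates it. *)
Lemma polar_basis V W k : @polar_pair R d V W k -> `|\det (homog V)| = k 0 ord_max ->
  `|\det (rowsub (widen_ord (leqnSn d)) V)| = 1.
Proof.
move=> VW detV; have k0 := proj1 VW ord_max.
have := congr1 Num.norm (polar_adj ord_max VW).
rewrite normrM normfV detV (gtr0_norm k0) divff ?gt_eqF//.
rewrite mxE /cofactor normrM normrX normrN1 expr1n mul1r => <-; congr `|\det _|.
apply/matrixP => i j; rewrite !mxE /homog.
case: splitP => [[[]//]|q]; rewrite lift0 => -[] jq.
by congr (V _ _); apply/val_inj; rewrite //= /bump leqNgt ltn_ord.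
Qed.

(** [U] below carries the basis of the first [d] vertices to the other one. The last vertex follows,
    since the relation [sum_i v_i / k_i = 0] has the same coefficients on both sides. *)
Lemma lattice_iso_same_weights V1 W1 V2 W2 k :
  @polar_pair R d V1 W1 k -> @polar_pair R d V2 W2 k ->
  V1 \is a mxOver Num.int -> V2 \is a mxOver Num.int ->
  `|\det (homog V1)| = k 0 ord_max -> `|\det (homog V2)| = k 0 ord_max ->
  lattice_iso (hull V1) (hull V2).
Proof.
move=> VW1 VW2 /int_mxE[B1 B1E] /int_mxE[B2 B2E] D1 D2.
pose h := widen_ord (leqnSn d).
have rsE (V : 'M[R]_(d.+1, d)) B : V = map_mx intr B ->
    rowsub h V = map_mx intr (rowsub h B).
  by move=> ->; apply/matrixP => i j; rewrite !mxE.
have uA1 : rowsub h B1 \in unitmx.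
  by apply: (@det_norm1_unitmx R); rewrite -(rsE _ _ B1E) (polar_basis VW1).
have uA2 : rowsub h B2 \in unitmx.
  by apply: (@det_norm1_unitmx R); rewrite -(rsE _ _ B2E) (polar_basis VW2).
pose U := invmx (rowsub h B1) *m rowsub h B2.
have uU : U \in unitmx by rewrite unitmx_mul unitmx_inv uA1.
apply: (lattice_iso_unitmx (polar_homog_unit VW1) (polar_homog_unit VW2) uU).
have rows i : row (h i) (V1 *m map_mx intr U) = row (h i) V2.
  rewrite row_mul -[row (h i) V1]row_rowsub -[row (h i) V2]row_rowsub -row_mul.
  by rewrite (rsE _ _ B1E) (rsE _ _ B2E) -map_mxM /U mulKVmx.
apply/row_matrixP => i; case: (unliftP ord_max i) => [j|] ->.
  by rewrite (_ : lift ord_max j = h j)//; apply/val_inj; rewrite /= /bump leqNgt ltn_ord.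
have [_ b1] := polar_bary VW1; have [_ b2] := polar_bary VW2.
have e : inv_row k *m (V1 *m map_mx intr U) = inv_row k *m V2.
  by rewrite mulmxA b1 b2 mul0mx.
move: e; rewrite !mulmx_sum_row !big_ord_recr/=.
rewrite (eq_bigr (fun i => inv_row k 0 (h i) *: row (h i) V2)) => [|j _]; last by rewrite -rows.
move/addrI/scalerI; apply; by rewrite mxE invr_eq0 gt_eqF// (proj1 VW1).
Qed.

End LatticeIso.

(** * Dual vertices that generate the lattice *)

Section Generation.
Variables (R : realType) (d : nat).

Lemma lattice_span_rows n (W : 'M[R]_(n, d)) :
  lattice_span (range (fun i => row i W)) `<=`
  [set x | exists2 c : 'rV[R]_n, c \is a mxOver Num.int & x = c *m W].
Proof.
apply: smallest_sub.
  split=> [|_ _ [a ai ->] [b bi ->]].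
    by exists 0; rewrite ?mul0mx//; apply/mxOverP => i j; rewrite mxE rpred0.
  exists (a - b); rewrite ?mulmxBl//; apply/mxOverP => i j.
  by rewrite !mxE rpredB// (mxOverP ai, mxOverP bi).
move=> _ [i _ <-]; exists (delta_mx 0 i); rewrite ?rowE//.
by apply/mxOverP => p q; rewrite mxE natr_int.
Qed.

(** If [C] is an integral left inverse of [W], then stacking the barycentric
    coordinates [1 / k_i] of [0] over [C] gives a left inverse of [homog W] up to a
    unitriangular factor; multiplied by [\det (homog V)] it is still integral. *)
Lemma generating_det_dvd (V W : 'M[R]_(d.+1, d)) k : polar_pair V W k ->
  V \is a mxOver Num.int ->
  lattice_span (range (fun i => row i W)) = lattice R d ->
  exists2 z, z \is a Num.int & \det (homog V) = z * \det (homog W).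
Proof.
move=> VW Vi gen; have [bs bW] := polar_bary (polar_pair_sym VW).
have /choice[c cE] : forall j, exists c : 'rV[R]_d.+1,
    c \is a mxOver Num.int /\ delta_mx 0 j = c *m W.
  move=> j; have : lattice R d (delta_mx 0 j).
    by apply/mxOverP => p q; rewrite mxE natr_int.
  by rewrite -gen => /lattice_span_rows[c ci cW]; exists c.
pose C := \matrix_j c j; pose D := \det (homog V).
have CW : C *m W = 1%:M.
  by apply/row_matrixP => j; rewrite row_mul rowK -(proj2 (cE j)) row1.
have Fdet (r : 'rV[R]_d.+1) : r = inv_row k ->
    \det (col_mx r C : 'M[R]_(1 + d)) * \det (homog W) = 1.
  move=> ->; rewrite -det_mulmx /homog (@mul_col_mx _ 1 d) !mul_mx_row bW CW.
  rewrite -block_mxEv (_ : inv_row k *m const_mx 1 = 1%:M) ?det_lblock ?det1 ?mulr1//.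
  apply/matrixP => i j; rewrite !ord1 !mxE -[RHS]bs.
  by apply: eq_bigr => p _; rewrite !mxE mulr1.
exists (\det (col_mx (D *: inv_row k) C : 'M[R]_(1 + d))).
  apply: det_int; apply/mxOverP => i j; case: (split_ordP (i : 'I_(1 + d))) => p ->.
    by rewrite col_mxEu !mxE (polar_det_dvd _ VW Vi).
  by rewrite col_mxEd mxE (mxOverP (proj1 (cE p))).
have -> : (col_mx (D *: inv_row k) C : 'M[R]_(1 + d)) =
    block_mx D%:M 0 0 1%:M *m col_mx (inv_row k) C.
  by rewrite mul_block_col !mul0mx addr0 add0r mul1mx mul_scalar_mx.
by rewrite det_mulmx det_ublock det1 mulr1 det_scalar1 -mulrA Fdet ?mulr1.
Qed.

End Generation.

(** * The Sylvester simplex and its dual *)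

Section SylvesterSimplex.
Variables (R : realType) (d : nat).

Definition sylvester_denom (i : 'I_d.+1) : nat :=
  if (i < d)%N then sylvester i else sylvester_t d.

Lemma sylvester_denom_gt0 i : (0 < sylvester_denom i)%N.
Proof. by rewrite /sylvester_denom; case: ifP => _; rewrite ?sylvester_gt0 ?sylvester_t_gt0. Qed.

Lemma prod_sylvester_denom : (\prod_i sylvester_denom i = sylvester_t d ^ 2)%N.
Proof.
rewrite big_ord_recr/= /sylvester_denom ltnn -mulnn [X in (_ = X * _)%N]sylvester_tE.
by congr muln; apply: eq_bigr => i _; rewrite /= ltn_ord.
Qed.

Lemma polar_sylvester_det (V W : 'M[R]_(d.+1, d)) :
  polar_pair V W (\row_i (sylvester_denom i)%:R) ->
  V \is a mxOver Num.int -> W \is a mxOver Num.int ->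
  `|\det (homog V)| = (sylvester_t d)%:R.
Proof.
move=> VW Vi Wi; have := polar_det VW.
have t0 : (sylvester_t d)%:R != 0 :> R by rewrite pnatr_eq0 -lt0n sylvester_t_gt0.
have kd : (\row_i (sylvester_denom i)%:R : 'rV[R]_d.+1) 0 ord_max = (sylvester_t d)%:R.
  by rewrite mxE /sylvester_denom ltnn.
have /= := polar_det_dvd ord_max VW Vi; rewrite kd => zi.
have /= := polar_det_dvd ord_max (polar_pair_sym VW) Wi; rewrite kd => z'i.
under eq_bigr do rewrite mxE.
rewrite -natr_prod prod_sylvester_denom natrX => DD'.
have : `|\det (homog V) / (sylvester_t d)%:R * (\det (homog W) / (sylvester_t d)%:R)| = 1.
  by rewrite mulf_div DD' -expr2 divff ?normr1// expf_neq0.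
move/(int_mul1_norm zi z'i); rewrite normrM normfV normr_nat => e.
by rewrite -[LHS](divfK t0) e mul1r.
Qed.

Definition sylvester_vertices : 'M[R]_(d.+1, d) :=
  \matrix_(i, j) ((sylvester_denom i)%:R *+ (i == j :> nat) - 1).

(** The dual vertex opposite to [-u] is [- sum_j (t_d / y_j) e_j], the other ones
    are the [e_j]. *)
Definition sylvester_dual_vertices : 'M[R]_(d.+1, d) :=
  \matrix_(i, j) if (i < d)%N then (i == j :> nat)%:R
                 else - (sylvester_t d %/ sylvester j)%N%:R.

Lemma sylvester_quotient j : (j < d)%N ->
  (sylvester_t d %/ sylvester j)%N%:R = (sylvester_t d)%:R / (sylvester j)%:R :> R.
Proof.
move=> jd; rewrite natf_div// ?sylvester_dvd_t//.
Qed.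

Lemma polar_sylvester :
  polar_pair sylvester_vertices sylvester_dual_vertices (\row_i (sylvester_denom i)%:R).
Proof.
split=> [i|]; first by rewrite mxE ltr0n sylvester_denom_gt0.
have t0 : (sylvester_t d)%:R != 0 :> R by rewrite pnatr_eq0 -lt0n sylvester_t_gt0.
rewrite /homog tr_row_mx mul_row_col; apply/matrixP => i j.
rewrite !mxE big_ord1 !mxE mulr1.
under eq_bigr do rewrite !mxE.
have [jd|dj] := ltnP j d.
  rewrite (bigD1 (Ordinal jd))//= eqxx mulr1 big1 ?addr0 => [|p pj].
    by rewrite addrC subrK.
  by rewrite (_ : (j == p :> nat) = false) ?mulr0//; apply/negbTE; rewrite eq_sym.
have -> : j = ord_max by apply/val_inj/eqP; rewrite eqn_leq -ltnS ltn_ord.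
(* Only the dual vertex opposite to [-u] needs arithmetic; splitting off the constant part of the
   pairing reduces it to [sum_inv_sylvester]. *)
have -> : \sum_(p < d) ((sylvester_denom i)%:R *+ (i == p :> nat) - 1) *
      - (sylvester_t d %/ sylvester p)%N%:R =
    (sylvester_t d)%:R * \sum_(p < d) (sylvester p)%:R^-1 -
    (sylvester_t d)%:R *
      \sum_(p < d) ((sylvester p)%:R^-1 * (sylvester_denom i)%:R *+ (i == p :> nat)) :> R.
  rewrite !mulr_sumr -sumrB; apply: eq_bigr => p _.
  by rewrite sylvester_quotient// -mulrnAr; ring.
rewrite sum_inv_sylvester mulrBr mulr1 divff//.
have [id|di] := ltnP i d.
  rewrite (bigD1 (Ordinal id))//= eqxx big1 ?addr0 => [|p pi]; last first.
    by rewrite (_ : (i == p :> nat) = false)//; apply/negbTE; rewrite eq_sym.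
  rewrite mulr1n /sylvester_denom id mulVf ?mulr1; last by rewrite pnatr_eq0 -lt0n sylvester_gt0.
  rewrite (_ : (i == ord_max) = false) ?mulr0n; first by ring.
  by apply/negbTE; rewrite -val_eqE/= neq_ltn id.
have -> : i = ord_max by apply/val_inj/eqP; rewrite eqn_leq -ltnS ltn_ord.
rewrite eqxx mulr1n big1 => [|p _]; last by rewrite /= gtn_eqF ?mulr0n.
by rewrite /sylvester_denom ltnn; ring.
Qed.

Lemma sylvester_vertices_int : sylvester_vertices \is a mxOver Num.int.
Proof. by apply/mxOverP => i j; rewrite mxE rpredB ?rpred1// rpredMn// natr_int. Qed.

Lemma sylvester_dual_vertices_int : sylvester_dual_vertices \is a mxOver Num.int.
Proof.
by apply/mxOverP => i j; rewrite mxE; case: ifP => _; rewrite ?rpredN natr_int.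
Qed.

Lemma S_sylvesterE : S_ R (@sylvester_weights d) = hull sylvester_vertices.
Proof.
rewrite /S_ -conv_hullE; congr conv_hull.
set u := (\sum_(i < d) delta_mx 0 i : 'rV[R]_d); have uE : u = const_mx 1.
  apply/rowP => j; rewrite /u summxE (bigD1 j)//= big1 ?addr0 ?mxE ?eqxx// => i ij.
  by rewrite mxE eq_sym (negbTE ij).
have t0 : (sylvester_t d)%:R != 0 :> R by rewrite pnatr_eq0 -lt0n sylvester_t_gt0.
(* The total weight is [t_d * (1 - 1 / t_d) + 1 = t_d], so [|Q| / q_i] is the Sylvester number
   [y_i]. *)
have QE : (\sum_j @sylvester_weights d j)%N%:R = (sylvester_t d)%:R :> R.
  rewrite big_ord_recr/= {2}/sylvester_weights ltnn natrD natr_sum.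
  rewrite (eq_bigr (fun i : 'I_d => (sylvester_t d)%:R * (sylvester i)%:R^-1)) => [|i _].
    by rewrite -mulr_sumr sum_inv_sylvester mulrBr divff// mulr1 subrK.
  by rewrite /sylvester_weights/= ltn_ord sylvester_quotient.
have rowE (i : 'I_d) :
    (\sum_j @sylvester_weights d j)%N%:R / (@sylvester_weights d (widen_ord (leqnSn d) i))%:R *:
      delta_mx 0 i - u = row (widen_ord (leqnSn d) i) sylvester_vertices.
  rewrite QE /sylvester_weights/= ltn_ord sylvester_quotient// uE.
  rewrite invf_div mulrCA divff// mulr1; apply/rowP => j; rewrite !mxE eqxx/=.
  by rewrite /sylvester_denom/= ltn_ord mulr_natr eq_sym -val_eqE.
have rowd : - u = row ord_max sylvester_vertices.
  by rewrite uE; apply/rowP => j; rewrite !mxE /= gtn_eqF// mulr0n sub0r.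
apply/seteqP; split=> x.
  move=> [[i _ <-]|->]; first by rewrite rowE; exists (widen_ord (leqnSn d) i).
  by rewrite rowd; exists ord_max.
move=> [i _ <-]; case: (unliftP ord_max i) => [j|] ->; last by right; rewrite rowd.
left; exists j => //; rewrite rowE; congr (row _ _).
by apply/val_inj; rewrite /= /bump leqNgt ltn_ord.
Qed.

End SylvesterSimplex.

(** * Unit fraction partitions in arbitrary order *)

Section UnitFractionsOrd.
Variables (R : realType) (d : nat) (k : 'I_d.+1 -> nat).
Hypothesis k_gt0 : forall i, (0 < k i)%N.
Hypothesis sum_k : \sum_i (k i)%:R^-1 = 1 :> R.

Lemma exists_sorting_perm : exists s : 'S_d.+1,
  forall i j : 'I_d.+1, (i <= j)%N -> (k (s i) <= k (s j))%N.
Proof.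
pose ks := [tuple k i | i < d.+1].
have /tuple_permP[s sE] : perm_eq (sort_tuple leq ks) ks by rewrite perm_sort.
have ksE i : tnth (sort_tuple leq ks) i = k (s i).
  by rewrite (tnth_nth 0%N) sE -tnth_nth !tnth_mktuple.
exists s => i j ij; rewrite -!ksE !(tnth_nth 0%N).
apply: (sorted_leq_nth leq_trans leqnn) => //; rewrite ?inE ?size_tuple//.
by apply: sort_sorted; exact: leq_total.
Qed.

Lemma unit_fractions_extremal : (sylvester_t d ^ 2 <= \prod_i k i)%N ->
  exists s : 'S_d.+1, forall i, k (s i) = sylvester_denom i.
Proof.
move=> tk; have [s s_mono] := exists_sorting_perm; exists s => i.
(* Beyond [d], [inord] falls back to index 0, so [k'] is positive at every natural number. *)
pose k' n := k (s (inord n)).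
have k'E (j : 'I_d.+1) : k' j = k (s j) by rewrite /k' inord_val.
have := @unit_fraction_extremal R d k'.
rewrite -k'E => -> //.
- by move=> n; exact: k_gt0.
- by move=> n nd; rewrite s_mono// !inordK// ltnS// ltnW.
- under eq_bigr do rewrite k'E.
  by rewrite -[RHS]sum_k [RHS](reindex_inj (@perm_inj _ s)).
- under eq_bigr do rewrite k'E.
  by move: tk; rewrite (reindex_inj (@perm_inj _ s)).
- by rewrite -ltnS.
Qed.

(** A larger product would meet the hypothesis of [unit_fractions_extremal], whose conclusion makes
    the product exactly [t_d^2]. *)
Lemma unit_fractions_prod_le : (\prod_i k i <= sylvester_t d ^ 2)%N.
Proof.
rewrite leqNgt; apply/negP => lt; have [s sE] := unit_fractions_extremal (ltnW lt).
move: lt; rewrite (reindex_inj (@perm_inj _ s))/=.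
by under eq_bigr do rewrite sE; rewrite prod_sylvester_denom ltnn.
Qed.

Lemma unit_fractions_prod_ge : (d.+1 ^ d.+1 <= \prod_i k i)%N /\
  ((\prod_i k i = d.+1 ^ d.+1)%N <-> forall i, k i = d.+1).
Proof.
pose E i : R := (k i)%:R^-1.
have k0 i : (k i)%:R != 0 :> R by rewrite pnatr_eq0 -lt0n.
have K0 : 0 < (\prod_i k i)%N%:R :> R by rewrite ltr0n prodn_gt0.
have : \prod_i (E i *+ d.+1) <= 1 ?= iff
    [forall i in predT, forall j in predT, E i == E j].
  rewrite -[X in _ <= X ?= iff _](expr1n _ d.+1) -[X in X ^+ d.+1]sum_k.
  have := @leif_AGM_scaled R 'I_d.+1 predT E; rewrite card_ord; apply => i _.
  by rewrite mulrn_wge0// invr_ge0.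
under eq_bigr do rewrite -mulr_natr.
rewrite big_split/= prodr_const card_ord prodfV -natr_prod -natrX mulrC => -[le1 eq1].
split; first by move: le1; rewrite ler_pdivrMr// mul1r ler_nat.
split=> [Kd|kd].
  move: eq1; rewrite -Kd divff ?(gt_eqF K0)// eqxx => /esym/forall_inP H i.
  have kk j : k j = k i.
    have /forall_inP/(_ i isT)/eqP/invr_inj/eqP := H j isT; rewrite eqr_nat => /eqP//.
  have := sum_k; under eq_bigr do rewrite kk.
  rewrite sumr_const card_ord -[X in X = _]mulr_natl => /divr1_eq e; apply/esym/eqP.
  by rewrite -(eqr_nat R) e.
by under eq_bigr do rewrite kd; rewrite prod_nat_const card_ord.
Qed.

End UnitFractionsOrd.

(** * Bounds and equality cases *)

Section Main.
Variables (R : realType) (d : nat).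

Lemma hull_row_perm n (s : 'S_n) (V : 'M[R]_(n, d)) : hull (row_perm s V) = hull V.
Proof.
by rewrite -!conv_hullE; congr conv_hull; apply/seteqP; split=> _ [i _ <-];
  [exists (s i)|exists ((s^-1)%g i)] => //; apply/rowP => j; rewrite !mxE ?permKV.
Qed.

Lemma polar_row_perm (s : 'S_d.+1) (V W : 'M[R]_(d.+1, d)) k : polar_pair V W k ->
  polar_pair (row_perm s V) (row_perm s W) (col_perm s k).
Proof.
move=> [k0 VW]; split=> [i|]; first by rewrite mxE.
have homogE (A : 'M[R]_(d.+1, d)) i j : homog (row_perm s A) i j = homog A (s i) j.
  by rewrite /homog; case: (split_ordP j) => p ->; rewrite ?row_mxEl ?row_mxEr !mxE.
apply/matrixP => i j; transitivity ((homog V *m (homog W)^T) (s i) (s j)).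
  rewrite [LHS]mxE [RHS]mxE; apply: eq_bigr => p _.
  by rewrite [X in _ * X = _]mxE [X in _ = _ * X]mxE !homogE.
by rewrite VW !mxE (inj_eq perm_inj).
Qed.

Lemma polar_sum_inv (V W : 'M[R]_(d.+1, d)) (k : 'I_d.+1 -> nat) :
  polar_pair V W (\row_i (k i)%:R) -> \sum_i (k i)%:R^-1 = 1 :> R.
Proof.
by move=> /polar_bary[e _]; rewrite -[RHS]e; apply: eq_bigr => i _; rewrite mxE.
Qed.

Lemma polar_weights_gt0 (V W : 'M[R]_(d.+1, d)) (k : 'I_d.+1 -> nat) i :
  polar_pair V W (\row_i (k i)%:R) -> (0 < k i)%N.
Proof. by move=> [/(_ i)]; rewrite mxE ltr0n. Qed.

Lemma polar_sylvester_order (V W : 'M[R]_(d.+1, d)) (k : 'I_d.+1 -> nat) :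
  polar_pair V W (\row_i (k i)%:R) -> V \is a mxOver Num.int -> W \is a mxOver Num.int ->
  (\prod_i k i = sylvester_t d ^ 2)%N ->
  exists V' W', [/\ polar_pair V' W' (\row_i (@sylvester_denom d i)%:R),
    V' \is a mxOver Num.int, W' \is a mxOver Num.int, hull V = hull V' & hull W = hull W'].
Proof.
move=> VW Vi Wi kt.
have [s sE] : exists s : 'S_d.+1, forall i, k (s i) = sylvester_denom i.
  apply: (@unit_fractions_extremal R); last by rewrite kt.
    by move=> i; exact: polar_weights_gt0 VW.
  exact: polar_sum_inv VW.
exists (row_perm s V), (row_perm s W); rewrite !hull_row_perm; split=> //.
- rewrite (_ : \row_i _ = col_perm s (\row_i (k i)%:R)); first exact: polar_row_perm.
  by apply/rowP => i; rewrite !mxE sE.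
- by apply/mxOverP => i j; rewrite mxE (mxOverP Vi).
- by apply/mxOverP => i j; rewrite mxE (mxOverP Wi).
Qed.

Lemma sylvester_lattice_iso (V1 W1 V2 W2 : 'M[R]_(d.+1, d)) :
  polar_pair V1 W1 (\row_i (@sylvester_denom d i)%:R) ->
  polar_pair V2 W2 (\row_i (@sylvester_denom d i)%:R) ->
  V1 \is a mxOver Num.int -> W1 \is a mxOver Num.int ->
  V2 \is a mxOver Num.int -> W2 \is a mxOver Num.int ->
  lattice_iso (hull V1) (hull V2).
Proof.
move=> VW1 VW2 V1i W1i V2i W2i; apply: (lattice_iso_same_weights VW1 VW2) => //.
  by rewrite (polar_sylvester_det VW1)// mxE /sylvester_denom ltnn.
by rewrite (polar_sylvester_det VW2)// mxE /sylvester_denom ltnn.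
Qed.

Lemma lattice_iso_sylvester_prod (V W : 'M[R]_(d.+1, d)) (k : 'I_d.+1 -> nat) :
  polar_pair V W (\row_i (k i)%:R) -> lattice_iso (hull V) (S_ R (@sylvester_weights d)) ->
  (\prod_i k i = sylvester_t d ^ 2)%N.
Proof.
move=> VW; rewrite S_sylvesterE => /(lattice_iso_polar VW (polar_sylvester R d))[s sE].
rewrite -prod_sylvester_denom (reindex_inj (@perm_inj _ s))/=; apply: eq_bigr => i _.
by have := sE i; rewrite !mxE => /eqP; rewrite eqr_nat => /eqP.
Qed.

Lemma sum_vertices (V W : 'M[R]_(d.+1, d)) k : polar_pair V W k ->
  \sum_(v \in vertices (hull V)) v = const_mx 1 *m V.
Proof.
move=> VW; rewrite (polar_vertices VW) fsbig_image; last first.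
  by move=> i j _ _; exact: (polar_row_inj VW).
rewrite mulmx_sum_row (_ : [set: 'I_d.+1] = [set` index_enum 'I_d.+1]).
  rewrite -fsbig_seq ?index_enum_uniq//; apply: eq_bigr => i _.
  by rewrite mxE scale1r.
by apply/seteqP; split=> i //= _; rewrite mem_index_enum.
Qed.

(** The sum vanishes exactly when the uniform weights [1 / (d + 1)] are the barycentric coordinates
    of the origin, and those are unique. *)
Lemma sum_vertices_eq0 (V W : 'M[R]_(d.+1, d)) (k : 'I_d.+1 -> nat) :
  polar_pair V W (\row_i (k i)%:R) ->
  \sum_(v \in vertices (hull V)) v = 0 <-> forall i, k i = d.+1.
Proof.
move=> VW; rewrite (sum_vertices VW); split=> [V0 i|kd].
  pose l : 'rV[R]_d.+1 := const_mx d.+1%:R^-1.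
  have lE : l = d.+1%:R^-1 *: const_mx 1 by apply/rowP => j; rewrite !mxE mulr1.
  have lV : l *m V = 0 by rewrite lE -scalemxAl V0 scaler0.
  have l1 : \sum_j l 0 j = 1.
    under eq_bigr do rewrite mxE.
    by rewrite sumr_const card_ord -[LHS]mulr_natl divff// pnatr_eq0.
  have /rowP/(_ i) := polar_bary_uniq VW lV l1; rewrite !mxE => /invr_inj/eqP.
  by rewrite eqr_nat => /eqP.
have [_ bV] := polar_bary VW.
have -> : const_mx 1 = d.+1%:R *: inv_row (\row_i (k i)%:R) :> 'rV[R]_d.+1.
  by apply/rowP => i; rewrite !mxE kd divff// pnatr_eq0.
by rewrite -scalemxAl bV scaler0.
Qed.

End Main.

Theorem theoremC (R : realType) (d : nat) (P : set 'rV[R]_d) :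
  (2 <= d)%N -> reflexive_polytope P -> simplex P ->
  let S := S_ R (@sylvester_weights d) in
  let t := sylvester_t d in
  [/\ ((d.+1 ^ d.+1)%N%:R%:E <= Vol P * Vol (dual_polytope P) <= (t ^ 2)%N%:R%:E)%E,
      (Vol P * Vol (dual_polytope P) = (d.+1 ^ d.+1)%N%:R%:E)%E <->
        \sum_(v \in vertices P) v = 0,
      (Vol P * Vol (dual_polytope P) = (t ^ 2)%N%:R%:E)%E <-> lattice_iso P S,
      (Vol P * Vol (dual_polytope P) = (t ^ 2)%N%:R%:E)%E -> lattice_iso P (dual_polytope P) &
      lattice_span (vertices (dual_polytope P)) = lattice R d ->
        (Vol (dual_polytope P) <= t%:R%:E)%E /\
        (Vol (dual_polytope P) = t%:R%:E <->
           lattice_iso (dual_polytope P) S /\ lattice_iso S P)].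
Proof.
move=> _ reflP simpP S t.
have [V [W [k [PE VW Vi Wi]]]] := reflexive_simplex_polar reflP simpP.
have WV := polar_pair_sym VW.
have k_gt0 i : (0 < k i)%N by exact: polar_weights_gt0 VW.
have sum_k := polar_sum_inv VW.
rewrite PE (polar_dual VW) (polar_vertices WV) (Vol_hull VW) (Vol_hull WV) -EFinM.
set D := \det (homog V); set D' := \det (homog W).
have DD' : `|D| * `|D'| = (\prod_i k i)%N%:R.
  rewrite -normrM (polar_det VW) natr_prod ger0_norm; last first.
    by apply: prodr_ge0 => i _; rewrite mxE.
  by apply: eq_bigr => i _; rewrite mxE.
have K_le := unit_fractions_prod_le k_gt0 sum_k.
have [K_ge K_eq] := unit_fractions_prod_ge k_gt0 sum_k.
have prodE n : ((`|D| * `|D'|)%:E = n%:R%:E)%E <-> (\prod_i k i)%N = n.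
  by rewrite DD'; split=> [[/eqP]|->//]; rewrite eqr_nat => /eqP.
(* Stated for an arbitrary polar pair so that it serves both [(V, W)] and the dual pair [(W, V)]. *)
have isoS V' W' (k' : 'I_d.+1 -> nat) : polar_pair V' W' (\row_i (k' i)%:R) ->
    V' \is a mxOver Num.int -> W' \is a mxOver Num.int ->
    (\prod_i k' i = t ^ 2)%N ->
    [/\ lattice_iso (hull V') S, lattice_iso S (hull V'),
      lattice_iso (hull V') (hull W') & Vol (hull V') = t%:R%:E].
  move=> VW' V'i W'i /(polar_sylvester_order VW' V'i W'i)[V1 [W1 [VW1 V1i W1i -> ->]]].
  have SV := sylvester_vertices_int R d; have SW := sylvester_dual_vertices_int R d.
  have SVW := polar_sylvester R d.
  rewrite /S S_sylvesterE (Vol_hull VW1) (polar_sylvester_det VW1)//; split=> //.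
  - exact: sylvester_lattice_iso VW1 SVW _ _ _ _.
  - exact: sylvester_lattice_iso SVW VW1 _ _ _ _.
  - exact: sylvester_lattice_iso VW1 (polar_pair_sym VW1) _ _ _ _.
split.
- by rewrite DD' !lee_fin !ler_nat K_ge.
- by rewrite prodE K_eq (sum_vertices_eq0 VW).
- rewrite prodE; split=> [/(isoS _ _ _ VW Vi Wi)[]//|].
  exact: (lattice_iso_sylvester_prod VW).
- by rewrite prodE => /(isoS _ _ _ VW Vi Wi)[].
move=> /(generating_det_dvd VW Vi)[z zi zE].
have D_neq0 : D != 0 by rewrite -unitfE -unitmxE (polar_homog_unit VW).
have le_D : `|D'| <= `|D|.
  rewrite /D zE normrM -[leLHS]mul1r ler_wpM2r// norm_intr_ge1//.
  by apply: contra D_neq0 => /eqP z0; rewrite /D zE z0 mul0r.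
(* Divisibility gives [|D'| <= |D|], hence [|D'|^2 <= |D| * |D'| <= t^2]; if [|D'| = t], both
   inequalities are equalities and the equality case applies. *)
have le_sqr : `|D'| ^+ 2 <= `|D| * `|D'| by rewrite expr2 ler_wpM2r.
have le_t : `|D| * `|D'| <= t%:R ^+ 2 by rewrite DD' -natrX ler_nat.
split.
  rewrite lee_fin -(@ler_pXn2r _ 2) ?nnegrE//.
  exact: le_trans le_t.
split=> [[D't]|[iso_dual _]].
  have K_t : (\prod_i k i = t ^ 2)%N.
    apply/prodE; congr _%:E; apply/eqP.
    by rewrite natrX eq_le le_t -D't le_sqr.
  have [_ iso1 _ _] := isoS _ _ _ VW Vi Wi K_t.
  by have [iso2 _ _ _] := isoS _ _ _ WV Wi Vi K_t.
have K_t := lattice_iso_sylvester_prod WV iso_dual.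
by have [_ _ _] := isoS _ _ _ WV Wi Vi K_t; rewrite (Vol_hull WV).
Qed.
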